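(* Let $d\ge 2$ and let $D\subset\mathbb{R}^d$ be a domain (connected open set). Assume: (A.1) for every $a\in\partial D$ there are a neighbourhood $W_a$ of $a$ in $\mathbb{R}^d$ and a bi-Lipschitz map $\Psi_a$ from $B(1)$ onto $W_a$ such that $\Psi_a(0)=a$ and $\Psi_a(B_+(1))=W_a\cap D$; (A.3) $(\mathcal{E}^0,H^1(D))$ is a regular Dirichlet form on $L^2(\overline{D},m)$, that is, $H^1(D)\cap C_c(\overline{D})$ is dense both in $(H^1(D),\|\cdot\|_{H^1(D)})$ and in $(C_c(\overline{D}),\|\cdot\|_\infty)$. Let $\sigma=\mathbf{1}_{\partial D}\cdot\mathcal{H}^{d-1}$, where $\mathcal{H}^{d-1}$ is the $(d-1)$-dimensional Hausdorff measure on $\mathbb{R}^d$. Then $\sigma$ is a Radon measure on $(\partial D,\mathcal{B}(\partial D))$. Moreover, if $A\subset\partial D$ satisfies $\mathrm{Cap}_{\overline{D}}(A)=0$, then $\sigma(A)=0$.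
   Context: $m$ is $d$-dimensional Lebesgue measure. $B(r)$ is the open ball of $\mathbb{R}^d$ of radius $r$ centred at the origin, and $B_+(r)=\{x\in B(r): x_d>0\}$. $\partial D=\overline D\setminus D$. $H^1(D)$ is the first-order $L^2$-Sobolev space with $\|f\|_{H^1(D)}^2=\int_D|\nabla f|^2dx+\int_D f^2dx$, and $\mathcal{E}^0(f,g)=\frac12\int_D(\nabla f,\nabla g)\,dx$ for $f,g\in H^1(D)$. (A.1) implies $m(\partial D)=0$, so $L^2(D,m)=L^2(\overline D,m)$. $\mathrm{Cap}_{\overline{D}}$ is the capacity of the regular Dirichlet form $(\mathcal{E}^0,H^1(D))$ on $L^2(\overline{D},m)$; up to comparable constants (hence with the same null sets), for $A\subset\overline{D}$, $\mathrm{Cap}_{\overline{D}}(A)=\inf\|f\|^2_{H^1(D)}$, the infimum being over all $f\in H^1(D)$ such that $f\ge 1$ $m$-a.e. on $O\cap D$ for some open $O\subset\mathbb{R}^d$ with $A\subset O$. *)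

(* Defs.v *)
From HB Require Import structures.
From mathcomp Require Import all_boot all_order all_algebra.
From mathcomp Require Import all_classical all_reals all_analysis.
Set Implicit Arguments.
Unset Strict Implicit.
Unset Printing Implicit Defensive.
Import Order.TTheory GRing.Theory Num.Theory.
Import numFieldNormedType.Exports.
Local Open Scope classical_set_scope.
Local Open Scope ring_scope.

(* R^d is 'rV[R]_d with the library topology, generated by the sup norm; all
   metric notions below use the Euclidean norm instead, which the library does
   not provide. *)
Definition enorm (R : realType) (d : nat) (x : 'rV[R]_d) : R :=
  Num.sqrt (\sum_(i < d) x 0 i ^+ 2).

Definition eball (R : realType) (d : nat) (r : R) : set 'rV[R]_d :=
  [set x | enorm x < r].

(* The last coordinate is the one whose index is d.-1. *)
Definition upper_half (R : realType) (d : nat) (r : R) : set 'rV[R]_d :=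
  [set x | eball r x /\ forall i : 'I_d, i = d.-1 :> nat -> 0 < x 0 i].

(* Not the library's topological boundary: it coincides with it for D open. *)
Definition bd (R : realType) (d : nat) (D : set 'rV[R]_d) : set 'rV[R]_d :=
  closure D `\` D.

Section borel_rV.
Context (R : realType) (d : nat).

Let borel_set0 : <<s (@open 'rV[R]_d) >> set0.
Proof. exact: sigma_algebra0. Qed.

Let borel_setC A : <<s (@open 'rV[R]_d) >> A -> <<s (@open 'rV[R]_d) >> (~` A).
Proof. exact: sigma_algebraC. Qed.

Let borel_bigcup (F : (set 'rV[R]_d)^nat) :
  (forall i, <<s (@open 'rV[R]_d) >> (F i)) ->
  <<s (@open 'rV[R]_d) >> (\bigcup_i F i).
Proof. exact: sigma_algebra_bigcup. Qed.

HB.instance Definition _ := @isMeasurable.Build default_measure_display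
  'rV[R]_d <<s (@open 'rV[R]_d) >> borel_set0 borel_setC borel_bigcup.

End borel_rV.

Section lebesgue_tuple.
Context (R : realType).
Local Notation gR := (measurableTypeR R).

Definition tuple_cons (n : nat) (x : gR * n.-tuple gR) : n.+1.-tuple gR :=
  [tuple of x.1 :: x.2].

Lemma measurable_tuple_cons (n : nat) : measurable_fun setT (@tuple_cons n).
Proof. exact: (@measurable_cons _ _ _ _ fst n snd). Qed.

HB.instance Definition _ (n : nat) :=
  isMeasurableFun.Build _ _ _ _ (@tuple_cons n) (@measurable_tuple_cons n).

Definition nil_measure : set (0.-tuple gR) -> \bar R := dirac [tuple].

HB.instance Definition _ :=
  Measure.copy nil_measure (@dirac _ (0.-tuple gR) [tuple] R).

Lemma nil_measure_sigma_finite : sigma_finite setT nil_measure.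
Proof.
exists (fun=> setT); first by rewrite bigcup_const.
by move=> _; split => //; rewrite /nil_measure diracT ltry.
Qed.

HB.instance Definition _ :=
  Measure_isSigmaFinite.Build _ _ _ nil_measure nil_measure_sigma_finite.

Section cons_measure.
Context (n : nat) (mu : {sigma_finite_measure set (n.-tuple gR) -> \bar R}).

Definition cons_measure : set (n.+1.-tuple gR) -> \bar R :=
  pushforward (@lebesgue_measure R \x mu)%E (@tuple_cons n).

Let cons_measure0 : cons_measure set0 = 0%E.
Proof. by rewrite /cons_measure /pushforward preimage_set0 measure0. Qed.

Let cons_measure_ge0 A : (0 <= cons_measure A)%E.
Proof. exact: measure_ge0. Qed.

Let cons_measure_sigma_additive : semi_sigma_additive cons_measure.
Proof.
apply: measure_semi_sigma_additive; exact: measurable_tuple_cons.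
Qed.

HB.instance Definition _ := isMeasure.Build _ _ _
  cons_measure cons_measure0 cons_measure_ge0 cons_measure_sigma_additive.

Lemma cons_measure_sigma_finite : sigma_finite setT cons_measure.
Proof.
have /sigma_finiteP[F [TF ndF Foo]] := sigma_finiteT (@lebesgue_measure R).
have /sigma_finiteP[G [TG ndG Goo]] := sigma_finiteT mu.
exists (fun k => [set t | F k (thead t) /\ G k [tuple of behead t]]).
  apply/seteqP; split => // t _.
  have [k _ Fk] : (\bigcup_k F k) (thead t) by rewrite -TF.
  have [l _ Gl] : (\bigcup_k G k) [tuple of behead t] by rewrite -TG.
  exists (maxn k l) => //=; split.
    by move: Fk; exact/subsetPset/ndF/leq_maxl.
  by move: Gl; exact/subsetPset/ndG/leq_maxr.
move=> k; have [mF Fk] := Foo k; have [mG Gk] := Goo k; split.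
  apply: measurableI.
    rewrite -[X in measurable X]setTI; exact: measurable_tnth.
  rewrite -[X in measurable X]setTI; exact: measurable_behead.
rewrite /cons_measure /pushforward.
rewrite (_ : _ @^-1` _ = F k `*` G k); last first.
  have tE (x : gR * n.-tuple gR) : [tuple of behead (tuple_cons x)] = x.2.
    exact/val_inj.
  by apply/seteqP; split => -[x t] /=; rewrite tE theadE.
by rewrite product_measure1E// lte_mul_pinfty// ge0_fin_numE.
Qed.

HB.instance Definition _ :=
  Measure_isSigmaFinite.Build _ _ _ cons_measure cons_measure_sigma_finite.

End cons_measure.

Fixpoint lebesgue_tuple (n : nat) :
    {sigma_finite_measure set (n.-tuple gR) -> \bar R} :=
  match n with
  | 0 => nil_measure
  | m.+1 => cons_measure (lebesgue_tuple m)
  end.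

Definition row_of_tuple (n : nat) (t : n.-tuple gR) : 'rV[R]_n :=
  \row_(i < n) tnth t i.

Lemma measurable_row_of_tuple (n : nat) : measurable_fun setT (@row_of_tuple n).
Proof.
apply: (@measurability _ _ _ _ _ _ (@open 'rV[R]_n)) => //.
move=> _ [U oU <-]; rewrite setTI.
pose box (p : 'rV[rat]_n * nat) : set 'rV[R]_n :=
  [set y | forall i, ball (ratr (p.1 0 i) : R) p.2.+1%:R^-1 (y 0 i)].
have -> : U = \bigcup_p (if `[< box p `<=` U >] then box p else set0).
  apply/seteqP; split => [x Ux|x [p _]]; last first.
    by case: asboolP => // + ; apply.
  have /nbhs_ballP[e /= e0 xeU] : nbhs x U by exact: open_nbhs_nbhs.
  have [k ke] : exists k, k.+1%:R^-1 < e / 2.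
    have /cvgrPdist_lt/(_ _ (divr_gt0 e0 (ltr0Sn R 1))) [k _ /(_ k (leqnn k))] :=
      @cvg_harmonic R.
    by rewrite sub0r normrN /= ger0_norm ?invr_ge0// => ke; exists k.
  have /choice[q qP] : forall i, exists q : rat,
      ball (x 0 i) (k.+1%:R^-1 : R) (ratr q).
    move=> i; have k0 : (0 : R) < k.+1%:R^-1 by rewrite invr_gt0.
    have xlt : x 0 i - k.+1%:R^-1 < x 0 i + k.+1%:R^-1.
      by rewrite ltrBlDr -addrA ltrDl addr_gt0.
    have [q] := rat_in_itvoo xlt; rewrite in_itv/= => /andP[q1 q2].
    by exists q; rewrite /ball/= ltr_distlC q1.
  exists (\row_i q i, k) => //; case: asboolP => [_ i|]; last first.
    case => y yb; apply: xeU; split => // a i; rewrite [a]ord1.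
    apply: le_ball (ball_triangle (qP i) _); last first.
      by have := yb i; rewrite /= mxE; exact.
    by rewrite ltW// [ltRHS]splitr ltrD.
  by rewrite mxE; exact/ball_sym/qP.
rewrite preimage_bigcup; apply: countable_bigcupT_measurable => [|p].
  exact: countableP.
case: asboolP => _; last by rewrite preimage_set0.
rewrite (_ : _ @^-1` _ = \bigcap_i (@tnth n gR ^~ i) @^-1`
    ball (ratr (p.1 0 i) : R) p.2.+1%:R^-1); last first.
  apply/seteqP; split => t /= tp i; first by move=> _; have := tp i; rewrite mxE.
  by rewrite mxE; exact: tp.
apply: fin_bigcap_measurable => // i _; rewrite -[X in measurable X]setTI.
apply: measurable_tnth => //; rewrite ball_itv; exact: measurable_itv.
Qed.

Definition lebesgue_rV (n : nat) : set 'rV[R]_n -> \bar R :=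
  pushforward (lebesgue_tuple n) (@row_of_tuple n).

Let lebesgue_rV0 (n : nat) : @lebesgue_rV n set0 = 0%E.
Proof. by rewrite /lebesgue_rV /pushforward preimage_set0 measure0. Qed.

Let lebesgue_rV_ge0 (n : nat) A : (0 <= @lebesgue_rV n A)%E.
Proof. exact: (measure_ge0 (lebesgue_tuple n)). Qed.

Let lebesgue_rV_sigma_additive (n : nat) : semi_sigma_additive (@lebesgue_rV n).
Proof.
apply: measure_semi_sigma_additive; exact: measurable_row_of_tuple.
Qed.

HB.instance Definition _ (n : nat) := isMeasure.Build _ _ _ (@lebesgue_rV n)
  (@lebesgue_rV0 n) (@lebesgue_rV_ge0 n) (@lebesgue_rV_sigma_additive n).

Lemma lebesgue_rV_prod (n : nat) (A : 'I_n -> set gR) :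
  (forall i, measurable (A i)) ->
  lebesgue_rV [set x : 'rV[R]_n | forall i, A i (x 0 i)] =
  (\prod_(i < n) @lebesgue_measure R (A i))%E.
Proof.
move=> mA; rewrite /lebesgue_rV /pushforward.
rewrite (_ : _ @^-1` _ = [set t | forall i, A i (tnth t i)]); last first.
  by apply/seteqP; split => t /= tA i; have := tA i; rewrite mxE.
elim: n A mA => [|n ih] A mA.
  rewrite big_ord0 /= /nil_measure (_ : [set _ | _] = setT) ?diracT//.
  by apply/seteqP; split => // t _ [].
rewrite big_ord_recl -ih//= /cons_measure /pushforward.
rewrite (_ : _ @^-1` _ =
    A ord0 `*` [set t | forall i, A (lift ord0 i) (tnth t i)]); last first.
  apply/seteqP; split => -[x t] /=.
    move=> xtA; split; first by have := xtA ord0.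
    by move=> i; have := xtA (lift ord0 i); rewrite tnthS.
  move=> [xA tA] i; have [j ->|->//] := unliftP ord0 i.
  by rewrite tnthS.
rewrite product_measure1E//.
rewrite (_ : mkset _ = \bigcap_i (@tnth n gR ^~ i) @^-1` A (lift ord0 i)).
  apply: fin_bigcap_measurable => // i _; rewrite -[X in measurable X]setTI.
  exact: measurable_tnth.
by apply/seteqP; split => t /= tA i; [move=> _|]; exact: tA.
Qed.

End lebesgue_tuple.

Section sobolev.
Context (R : realType) (d : nat).
Local Notation E := 'rV[R]_d.
Local Notation m := (@lebesgue_rV R d).

Definition pderiv (i : 'I_d) (f : E -> R) : E -> R :=
  fun x => 'D_(delta_mx 0 i) f x.

Definition smooth (f : E -> R) := forall s : seq 'I_d,
  continuous (foldr pderiv f s) /\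
  forall i x, derivable (foldr pderiv f s) x (delta_mx 0 i).

Definition test_function (D : set E) (phi : E -> R) :=
  smooth phi /\
  exists K, [/\ compact K, K `<=` D & forall x, ~ K x -> phi x = 0].

(* Elements of L^2(D) and H^1(D) are represented by functions on the whole
   space; only their values on D matter, up to null sets. Measurability is with
   respect to the Borel sets: every class has a Borel representative. *)
Definition L2 (D : set E) (f : E -> R) :=
  measurable_fun D f /\ (\int[m]_(x in D) (f x ^+ 2)%:E < +oo)%E.

Definition weak_gradient (D : set E) (f : E -> R) (g : E -> E) :=
  (forall i, L2 D (fun x => g x 0 i)) /\
  forall phi i, test_function D phi ->
    (\int[m]_(x in D) (f x * pderiv i phi x)%:E =
     - \int[m]_(x in D) (g x 0 i * phi x)%:E)%E.

Definition H1 (D : set E) (f : E -> R) :=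
  L2 D f /\ exists g, weak_gradient D f g.

(* Weak gradients are unique up to null sets, so the choice is irrelevant. *)
Definition grad (D : set E) (f : E -> R) : E -> E :=
  xget (fun=> 0) [set g | weak_gradient D f g].

Definition H1norm2 (D : set E) (f : E -> R) : \bar R :=
  (\int[m]_(x in D) (enorm (grad D f x) ^+ 2)%:E +
   \int[m]_(x in D) (f x ^+ 2)%:E)%E.

Definition Cc (F : set E) (u : E -> R) :=
  {within F, continuous u} /\
  exists K, [/\ compact K, K `<=` F & forall x, F x -> ~ K x -> u x = 0].

(* Regularity of the form on L^2(closure D): the two density conditions. *)
Definition regular_form (D : set E) :=
  (forall f e, H1 D f -> 0 < e ->
     exists u, [/\ H1 D u, Cc (closure D) u &
                   (H1norm2 D (f \- u)%R < (e ^+ 2)%:E)%E]) /\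
  (forall v e, Cc (closure D) v -> 0 < e ->
     exists u, [/\ H1 D u, Cc (closure D) u &
                   forall x, closure D x -> `|v x - u x| <= e]).

Definition Cap (D A : set E) : \bar R :=
  ereal_inf [set H1norm2 D f | f in [set f | H1 D f /\
    exists O, [/\ open O, A `<=` O &
                  {ae m, forall x, (O `&` D) x -> 1 <= f x}]]].

End sobolev.

Definition bilipschitz_on (R : realType) (d : nat) (B : set 'rV[R]_d)
    (psi : 'rV[R]_d -> 'rV[R]_d) :=
  exists2 L : R, 0 < L & forall x y, B x -> B y ->
    L^-1 * enorm (x - y) <= enorm (psi x - psi y) <= L * enorm (x - y).

Definition bilipschitz_boundary (R : realType) (d : nat) (D : set 'rV[R]_d) :=
  forall a, bd D a -> exists (W : set 'rV[R]_d) (psi : 'rV[R]_d -> 'rV[R]_d),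
    [/\ nbhs a W, bilipschitz_on (eball 1) psi, psi @` eball 1 = W,
        psi 0 = a & psi @` upper_half 1 = W `&` D].

Section hausdorff.
Context (R : realType) (d : nat).
Local Notation E := 'rV[R]_d.
Local Open Scope ereal_scope.

(* Equal to -oo on the empty set. *)
Definition ediam (U : set E) : \bar R :=
  ereal_sup [set (enorm (x.1 - x.2))%:E | x in U `*` U].

Definition hausdorff_gauge (s : nat) (U : set E) : \bar R :=
  if U == set0 then 0 else ediam U ^+ s.

Definition hausdorff_pre (s : nat) (delta : R) (A : set E) : \bar R :=
  ereal_inf [set \sum_(0 <= k <oo) hausdorff_gauge s (U k) |
    U in [set U : (set E)^nat | A `<=` \bigcup_k U k /\
                                forall k, ediam (U k) <= delta%:E]].

(* The s-dimensional Hausdorff outer measure, defined on all subsets of R^d and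
   without the factor making it agree with Lebesgue measure when s = d. *)
Definition hausdorff (s : nat) (A : set E) : \bar R :=
  ereal_sup [set hausdorff_pre s delta A | delta in [set delta | (0 < delta)%R]].

(* Like hausdorff, an outer measure: its vanishing on a set that is not Borel
   means that the set is contained in a Borel null set. *)
Definition surface (D A : set E) : \bar R := hausdorff d.-1 (A `&` bd D).

(* mu restricts to a Radon measure on X with its Borel sets, the traces on X of
   the Borel sets of R^d. *)
Definition radon_on (X : set E) (mu : set E -> \bar R) :=
  let B := strace measurable X in
  [/\ mu set0 = 0 /\ (forall A, B A -> 0 <= mu A),
      forall F : (set E)^nat, (forall k, B (F k)) -> trivIset setT F ->
        mu (\bigcup_k F k) = \sum_(0 <= k <oo) mu (F k),
      forall K, compact K -> K `<=` X -> mu K < +oo &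
      forall A, B A ->
        mu A = ereal_sup [set mu K | K in [set K | compact K /\ K `<=` A]]].

End hausdorff.

(* Main.v *)
(* Hausdorff measure is a metric outer measure, so Borel sets are Caratheodory
   measurable. A bi-Lipschitz chart maps a flat disc onto a neighbourhood in the
   boundary, so the surface measure is finite on compact sets, hence inner regular.

   For the second claim, the charts give for every boundary point [a] points [p k]
   in [D] and radii [r k], decreasing geometrically, with [|p k - a| <= C r k] and
   [ball (p k) (3 r k)] inside [D]. Let [f] be close to [0] in [H^1] and at least
   [1] near [A]. The averages of [f] against a bump function at scale [r k] around
   [p k] are small for [k = 0] and bounded below for large [k], while consecutive
   averages differ by integrals of the weak gradient [g] against explicit test
   functions, which bounds their difference by
   [r k ^ (1 - d)] times the integral of [|g|] over [ball (p k) (3 r k)]. Hence for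
   some [k] the energy of [f] in that ball is at least [c r k ^ (d - 1)], because
   otherwise the differences would be dominated by a small geometric series. A
   Vitali covering by such balls bounds the Hausdorff content of [A] by a multiple
   of the energy of [f]; no change of variables for Sobolev functions is needed. *)

From HB Require Import structures.
Require Import Defs.
From mathcomp Require Import all_boot all_order all_algebra.
From mathcomp Require Import all_classical all_reals all_analysis.
From mathcomp Require Import measurable_realfun ring lra.
Set Implicit Arguments.
Unset Strict Implicit.
Unset Printing Implicit Defensive.
Import Order.TTheory GRing.Theory Num.Theory.
Import numFieldNormedType.Exports.
Local Open Scope classical_set_scope.
Local Open Scope ring_scope.

(** * Hausdorff outer measure *)

(** The kernels are products of one-variable bumps [u'], where [u] is a smooth step from 0 to 1.
    Changing the base point and the scale in one coordinate replaces one bump by another in that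
    coordinate, and the difference of two such bumps is the derivative of a difference of two steps.
    The latter has compact support because both steps leave 0 and arrive at 1. Hence the difference
    of two kernels is a sum of partial derivatives of test functions, and the definition of the weak
    gradient applies directly, with no mollification of [f] and no Poincare inequality.

    The radii are the squares [(s * lam ^+ k) ^+ 2] because an energy of order [r k ^+ n] moves the
    average by the order of the square root of [r k], which is then the geometric term
    [s * lam ^+ k]. The ratio is close to 1, depending on the bi-Lipschitz constant, so that
    consecutive points are at distance at most [r k]. All balls are sup-norm balls, that is, cubes,
    which suits product functions and product measures. *)

Section enorm.
Context (R : realType) (d : nat).
Implicit Types x y : 'rV[R]_d.

Lemma le_coord_enorm x i : `|x 0 i| <= enorm x.
Proof.
rewrite -sqrtr_sqr ler_wsqrtr// (bigD1 i)//= lerDl.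
by apply: sumr_ge0 => j _; exact: sqr_ge0.
Qed.

Lemma enorm_le_sum x : enorm x <= \sum_i `|x 0 i|.
Proof.
have S0 : 0 <= \sum_i `|x 0 i| by exact: sumr_ge0.
rewrite -[leRHS]ger0_norm// -sqrtr_sqr ler_wsqrtr// expr2 mulr_suml.
apply: ler_sum => i _; rewrite -real_normK ?num_real// expr2 ler_wpM2l//.
by rewrite (bigD1 i)//= lerDl sumr_ge0.
Qed.

Lemma enorm_le x (r : R) : (forall i, `|x 0 i| <= r) -> enorm x <= d%:R * r.
Proof.
move=> xr; apply: le_trans (enorm_le_sum x) _.
rewrite mulr_natl -[X in _ *+ X]card_ord -sumr_const.
exact: ler_sum.
Qed.

End enorm.

Section norm_rV.
Context (R : realType) (n : nat).
Implicit Types x y : 'rV[R]_n.+1.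

Lemma norm_rV_le x (r : R) : 0 <= r -> (`|x| <= r) <-> (forall i, `|x 0 i| <= r).
Proof.
move=> r0; split => [xr i|xr].
  apply: le_trans xr; rewrite [`|x|]mx_normrE.
  exact: (le_bigmax _ (fun ij => `|x ij.1 ij.2|) (0, i)).
by rewrite [`|x|]mx_normrE; apply: bigmax_le => // -[i j] _; rewrite (ord1 i)/=.
Qed.

Lemma norm_rV_lt x (r : R) : 0 < r -> (`|x| < r) <-> (forall i, `|x 0 i| < r).
Proof.
move=> r0; split => [xr i|xr].
  by apply: le_lt_trans xr; have /norm_rV_le := lexx `|x|; apply.
by rewrite [`|x|]mx_normrE; apply: bigmax_lt => // -[i j] _; rewrite (ord1 i)/=.
Qed.

(** With this comparison and the next one the geometry is done with sup-norm balls; the Euclidean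
    norm enters only through the charts, the diameters and the size of a gradient. *)
Lemma norm_le_enorm x : `|x| <= enorm x.
Proof. by apply/norm_rV_le => [|i]; [exact: sqrtr_ge0 | exact: le_coord_enorm]. Qed.

Lemma enorm_le_norm x : enorm x <= n.+1%:R * `|x|.
Proof. by apply: enorm_le; exact/norm_rV_le. Qed.

End norm_rV.

Section hausdorff_outer_measure.
Context (R : realType) (d s : nat).
Local Notation E := 'rV[R]_d.
Implicit Types (U A B : set E).
Local Open Scope ereal_scope.

Lemma le_enorm_ediam U x y : U x -> U y -> (enorm (x - y))%:E <= ediam U.
Proof. by move=> Ux Uy; apply: ereal_sup_ubound; exists (x, y). Qed.

Lemma ediam_le U (c : R) :
  (forall x y, U x -> U y -> (enorm (x - y) <= c)%R) -> ediam U <= c%:E.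
Proof. by move=> Uc; apply: ge_ereal_sup => _ [[x y] [/= Ux Uy] <-]; rewrite lee_fin Uc. Qed.

Lemma ediam_ge0 U : U !=set0 -> 0 <= ediam U.
Proof.
by move=> [x Ux]; apply: le_trans (le_enorm_ediam Ux Ux); rewrite lee_fin sqrtr_ge0.
Qed.

Lemma hausdorff_gauge_ge0 U : 0 <= hausdorff_gauge s U.
Proof.
rewrite /hausdorff_gauge; case: ifPn => // /set0P U0.
by rewrite expe_ge0// ediam_ge0.
Qed.

Lemma hausdorff_gauge0 : hausdorff_gauge s (@set0 E) = 0.
Proof. by rewrite /hausdorff_gauge eqxx. Qed.

Lemma hausdorff_gauge_le U (c : R) : (0 <= c)%R ->
  (forall x y, U x -> U y -> (enorm (x - y) <= c)%R) ->
  hausdorff_gauge s U <= (c ^+ s)%:E.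
Proof.
move=> c0 Uc; rewrite /hausdorff_gauge; case: ifPn => [_|/set0P U0].
  by rewrite lee_fin exprn_ge0.
rewrite EFin_expe; have := ediam_le Uc; have := ediam_ge0 U0.
by elim: s => // k ih u0 uc; rewrite !expeS lee_pmul ?expe_ge0 ?ih.
Qed.

(** Charging [+oo] for a set that is too wide turns the restriction on covers into a value. The
    content becomes an instance of [mu_ext], over a sigma-algebra [T] in which every set is
    measurable, and inherits sigma-subadditivity. *)
Let G (delta : R) U := if ediam U <= delta%:E then hausdorff_gauge s U else +oo.

Let T := g_sigma_algebraType [set: set E].

Let G0 delta : (0 < delta)%R -> G delta set0 = 0.
Proof.
move=> d0; rewrite /G ifT ?hausdorff_gauge0//.
by apply: ediam_le => x y [].
Qed.

Let G_ge0 delta U : 0 <= G delta U.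
Proof. by rewrite /G; case: ifPn => // _; exact: hausdorff_gauge_ge0. Qed.

Let hausdorff_preE delta A : hausdorff_pre s delta A = @mu_ext _ T R (G delta) A.
Proof.
apply/eqP; rewrite eq_le; apply/andP; split.
  apply: le_ereal_inf_tmp => _ [F [mF AF] <-].
  have [Fd|/existsNP[k /negP Fk]] := pselect (forall k, ediam (F k : set E) <= delta%:E).
    apply: ereal_inf_lbound; exists F => //.
    by apply: eq_eseriesr => k _; rewrite /G Fd.
  rewrite (@eseries_pinfty _ (fun k => G delta (F k)) xpredT k) ?leey//.
    by move=> m _; rewrite gt_eqF// (lt_le_trans _ (G_ge0 _ _)).
  by rewrite /G (negbTE Fk).
apply: le_ereal_inf_tmp => _ [F [AF Fd] <-].
apply: ereal_inf_lbound; exists F.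
  by split => // k; exact: sub_sigma_algebra.
by apply: eq_eseriesr => k _; rewrite /G Fd.
Qed.

Lemma hausdorff_pre_ge0 delta A : 0 <= hausdorff_pre s delta A.
Proof. by rewrite hausdorff_preE mu_ext_ge0. Qed.

Lemma hausdorff_pre0 (delta : R) : (0 < delta)%R -> hausdorff_pre s delta (@set0 E) = 0.
Proof. by move=> d0; rewrite hausdorff_preE mu_ext0// G0. Qed.

Lemma le_hausdorff_pre delta A B : A `<=` B ->
  hausdorff_pre s delta A <= hausdorff_pre s delta B.
Proof. by move=> AB; rewrite !hausdorff_preE le_mu_ext. Qed.

Lemma hausdorff_pre_sigma_subadditive delta :
  sigma_subadditive (hausdorff_pre s delta : set E -> \bar R).
Proof.
move=> F; rewrite hausdorff_preE; under eq_eseriesr do rewrite hausdorff_preE.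
exact: (@mu_ext_sigma_subadditive _ T).
Qed.

Lemma hausdorff_pre_antimono (delta1 delta2 : R) A : (delta1 <= delta2)%R ->
  hausdorff_pre s delta2 A <= hausdorff_pre s delta1 A.
Proof.
move=> d12; apply: le_ereal_inf => _ [U [AU Ud] <-]; exists U => //; split => // k.
by apply: le_trans (Ud k) _; rewrite lee_fin.
Qed.

Lemma hausdorff_pre_le_gauge (delta : R) U : (0 < delta)%R -> ediam U <= delta%:E ->
  hausdorff_pre s delta U <= hausdorff_gauge s U.
Proof.
move=> d0 Ud; apply: ereal_inf_lbound; exists (fun k : nat => if k is 0%N return set E then U else set0).
  split => [x Ux|[//|k]]; first by exists 0%N.
  by apply: ediam_le => x y [].
rewrite nneseries_recl//; last by move=> *; exact: hausdorff_gauge_ge0.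
rewrite eseries_cond eseries0 ?adde0// => -[|k]//= _ _.
exact: hausdorff_gauge0.
Qed.

Lemma le_hausdorff_pre_hausdorff (delta : R) A : (0 < delta)%R ->
  hausdorff_pre s delta A <= hausdorff s A.
Proof. by move=> d0; apply: ereal_sup_ubound; exists delta. Qed.

Lemma hausdorff_le A c : (forall delta : R, (0 < delta)%R -> hausdorff_pre s delta A <= c) ->
  hausdorff s A <= c.
Proof. by move=> Ac; apply: ge_ereal_sup => _ [delta d0 <-]; exact: Ac. Qed.

Let hausdorff0 : hausdorff s (@set0 E) = 0.
Proof.
apply/eqP; rewrite eq_le; apply/andP; split.
  by apply: hausdorff_le => delta d0; rewrite hausdorff_pre0.
by apply: le_trans (le_hausdorff_pre_hausdorff _ (@ltr01 R)); exact: hausdorff_pre_ge0.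
Qed.

Let hausdorff_ge0 A : 0 <= hausdorff s A.
Proof.
by apply: le_trans (le_hausdorff_pre_hausdorff _ (@ltr01 R)); exact: hausdorff_pre_ge0.
Qed.

Let le_hausdorff : {homo @hausdorff R d s : A B / A `<=` B >-> A <= B}.
Proof.
move=> A B AB; apply: hausdorff_le => delta d0.
exact: le_trans (le_hausdorff_pre _ AB) (le_hausdorff_pre_hausdorff _ d0).
Qed.

Let hausdorff_sigma_subadditive : sigma_subadditive (hausdorff s : set E -> \bar R).
Proof.
move=> F; apply: hausdorff_le => delta d0.
apply: le_trans (hausdorff_pre_sigma_subadditive _ _) _.
apply: lee_nneseries => k _; first by move=> _; exact: hausdorff_pre_ge0.
exact: le_hausdorff_pre_hausdorff.
Qed.

HB.instance Definition _ := isOuterMeasure.Build R E (hausdorff s : set E -> \bar R)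
  hausdorff0 hausdorff_ge0 le_hausdorff hausdorff_sigma_subadditive.

End hausdorff_outer_measure.

Lemma cvge0_le (R : realType) (u : (\bar R)^nat) (e : R) :
  u @ \oo --> 0%E -> 0 < e -> exists m, (u m <= e%:E)%E.
Proof.
move=> /fine_cvgP[[m1 _ ufin] /cvgrPdist_le u0] e0.
have [m2 _ ue] := u0 _ e0; exists (maxn m1 m2).
rewrite -(@fineK _ (u _)); last by apply: ufin; exact: leq_maxl.
rewrite lee_fin; apply: le_trans (ler_norm _) _.
by have /= := ue (maxn m1 m2) (leq_maxr _ _); rewrite sub0r normrN.
Qed.

(** * Borel sets are Caratheodory measurable *)

Section hausdorff_borel.
Context (R : realType) (n s : nat).
Local Notation E := 'rV[R]_n.+1.
Local Notation H := (hausdorff s : set E -> \bar R).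
Implicit Types (U A B F X : set E).
Local Open Scope ereal_scope.

(** When [delta < t], a set of diameter at most [delta] cannot meet both [A] and [B], so a cover of
    the union splits into covers of each with no member counted twice. *)
Lemma hausdorff_metric A B (t : R) : (0 < t)%R ->
  (forall x y, A x -> B y -> (t <= `|x - y|)%R) -> H A + H B <= H (A `|` B).
Proof.
move=> t0 AB.
have pre (delta : R) : (delta < t)%R ->
    hausdorff_pre s delta A + hausdorff_pre s delta B <= hausdorff_pre s delta (A `|` B).
  move=> dt; apply: le_ereal_inf_tmp => _ [U [ABU Ud] <-].
  pose V (C : set E) k := if `[< U k `&` C !=set0 >] then U k else set0.
  have VP C : C `<=` A `|` B ->
      hausdorff_pre s delta C <= \sum_(0 <= k <oo) hausdorff_gauge s (V C k).
    move=> CAB; apply: ereal_inf_lbound; exists (V C) => //; split => [x Cx|k].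
      have [k _ Ukx] := ABU _ (CAB _ Cx); exists k => //; rewrite /V.
      by case: asboolP => // -[]; exists x.
    rewrite /V; case: asboolP => // _; apply: le_trans (Ud k).
    by apply: ge_ereal_sup => _ [[x y] [[]]].
  apply: le_trans (leeD (VP A _) (VP B _)) _ => //.
  rewrite -nneseriesD; [|by move=> *; exact: hausdorff_gauge_ge0..].
  apply: lee_nneseries => k _.
    by move=> _; rewrite adde_ge0 ?hausdorff_gauge_ge0.
  rewrite /V; case: asboolP => [[x [Ux Ax]]|_]; last first.
    by rewrite hausdorff_gauge0 add0e; case: asboolP => //; rewrite hausdorff_gauge0 hausdorff_gauge_ge0.
  case: asboolP => [[y [Uy By]]|_]; last by rewrite hausdorff_gauge0 adde0.
  have := le_trans (le_enorm_ediam Ux Uy) (Ud k); rewrite lee_fin => xyd.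
  by have := le_lt_trans (le_trans (AB _ _ Ax By) (norm_le_enorm _)) (le_lt_trans xyd dt); rewrite ltxx.
have [->|ABoo] := eqVneq (H (A `|` B)) +oo; first exact: leey.
have ABfin : H (A `|` B) \is a fin_num by rewrite ge0_fin_numE ?outer_measure_ge0// ltey.
have Bfin : H B \is a fin_num.
  by rewrite ge0_fin_numE ?outer_measure_ge0// (le_lt_trans _ (_ : H (A `|` B) < +oo)) ?ltey// le_outer_measure.
rewrite -leeBrDr//; apply: hausdorff_le => d1 d10.
rewrite leeBrDr// addeC.
have pfin C (delta : R) : (0 < delta)%R -> C `<=` A `|` B -> hausdorff_pre s delta C \is a fin_num.
  move=> d0 CAB; rewrite ge0_fin_numE ?hausdorff_pre_ge0//.
  apply: le_lt_trans (_ : H (A `|` B) < +oo); last by rewrite ltey.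
  by apply: le_trans (le_hausdorff_pre_hausdorff _ _ d0) _; exact: le_outer_measure.
rewrite -leeBrDr ?pfin//; apply: hausdorff_le => d2 d20.
rewrite leeBrDr ?pfin// addeC.
(* The two suprema bring two scales; a smaller common one only increases both contents, and [t / 2]
   makes the splitting available. *)
pose d3 := (Num.min (Num.min d1 d2) (t / 2))%R.
have d30 : (0 < d3)%R by rewrite !lt_min d10 d20 divr_gt0.
apply: (@le_trans _ _ (hausdorff_pre s d3 A + hausdorff_pre s d3 B)).
  by apply: leeD; apply: hausdorff_pre_antimono; rewrite /d3 !ge_min lexx ?orbT.
apply: le_trans (pre _ _) _; last exact: le_hausdorff_pre_hausdorff.
by rewrite /d3 gt_min ltr_pdivrMr// ltr_pMr// ltr1n orbT.
Qed.

(* The rings [shell k.+1] and the inner parts [far k] are separated, so that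
   the measures of the rings telescope. *)
Lemma closed_caratheodory F : closed F -> H.-caratheodory F.
Proof.
move=> cF; apply: le_caratheodory_measurable => X.
have [Xoo|Xoo] := eqVneq (H X) +oo.
  by apply: le_trans (leey _) _; rewrite -Xoo.
have Xfin : H X \is a fin_num by rewrite ge0_fin_numE ?outer_measure_ge0// ltey.
have fin C : C `<=` X -> H C \is a fin_num.
  move=> CX; rewrite ge0_fin_numE ?outer_measure_ge0//.
  by apply: le_lt_trans (_ : H X < +oo); [exact: le_outer_measure|rewrite ltey].
pose far k : set E := [set x | X x /\ forall y, F y -> (k.+1%:R^-1 <= `|x - y|)%R].
pose shell k := far k.+1 `\` far k.
have farX k : far k `<=` X by move=> x [].
have shellX k : shell k `<=` X by move=> x [[]].
have far_le k l : (k <= l)%N -> far k `<=` far l.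
  move=> kl x [Xx xF]; split => // y Fy; apply: le_trans (xF _ Fy).
  by rewrite lef_pV2 ?posrE// ler_nat.
have farF k : H (far k) + H (X `&` F) <= H X.
  apply: le_trans (hausdorff_metric (t := k.+1%:R^-1) _ _) _.
  - by rewrite invr_gt0.
  - by move=> x y [_ xF] [_ Fy]; exact: xF.
  - by apply: le_outer_measure => x [/farX//|[]].
have shell_le k : H (shell k.+1) + H (far k) <= H (far k.+2).
  apply: le_trans (hausdorff_metric (t := (k.+1%:R^-1 - k.+2%:R^-1)%R) _ _) _.
  - by rewrite subr_gt0 ltf_pV2 ?posrE// ltr_nat.
  (* A point of [shell k.+1] is missing from [far k.+1], hence nearer than [k.+2%:R^-1] to [F],
     while points of [far k] stay at least [k.+1%:R^-1] away. *)
  - move=> x z [[Xx _] nx] [Xz zF].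
    have [y [Fy xy]] : exists y, F y /\ (`|x - y| < k.+2%:R^-1)%R.
      apply: contrapT => /forallNP xF; apply: nx; split => // y Fy.
      by rewrite leNgt; apply/negP => xy; apply: (xF y).
    rewrite lerBlDr; apply: le_trans (zF _ Fy) _.
    by apply: le_trans (ler_distD x z y) _; rewrite (distrC z x) lerD2l ltW.
  - apply: le_outer_measure => x [[]//|]; apply: (far_le k).
    exact: leqW (leqnSn k).
(* The inequality skips one index, so its sum leaves two end terms; rings of even and of odd index
   are treated together. *)
have shell_sum m : \sum_(0 <= k < m) H (shell k.+1) <= H (far m.+1) + H (far m).
  elim: m => [|m ih]; first by rewrite big_nil adde_ge0// outer_measure_ge0.
  rewrite big_nat_recr//=; apply: le_trans (leeD2r _ ih) _.
  by rewrite -addeA [X in _ + X]addeC addeC leeD2r.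
have shell_fin : \sum_(0 <= k <oo) H (shell k.+1) < +oo.
  apply: (@le_lt_trans _ _ (H X + H X)); last by rewrite ltey_eq fin_numD Xfin.
  apply: lime_le; first by apply: is_cvg_nneseries => *; exact: outer_measure_ge0.
  apply: nearW => m; apply: le_trans (shell_sum m) _.
  by apply: leeD; exact: le_outer_measure.
have tail := nneseries_tail_cvg shell_fin (fun k _ => outer_measure_ge0 _ _).
have XF_le m : H (X `&` ~` F) <= H (far m.+1) + \sum_(m <= k <oo) H (shell k.+1).
  apply: le_trans (leeD2l _ (outer_measure_sigma_subadditive_tail _ m (fun k => shell k.+1))).
  apply: le_trans (outer_measureU2 _ _ _).
  apply: le_outer_measure => x [Xx nFx].
  (* Closedness of [F] enters here: a point off [F] has positive distance to it. *)
  have [k xk] : exists k, far k x.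
    have : nbhs x (~` F) by apply: open_nbhs_nbhs; split => //; exact: closed_openC.
    move=> /nbhs_ballP[e /= e0 xe].
    have [k ke] : exists k, (k.+1%:R^-1 < e)%R.
      have /cvgrPdist_lt/(_ _ e0) [k _ /(_ k (leqnn k))] := @cvg_harmonic R.
      by rewrite sub0r normrN /= ger0_norm ?invr_ge0// => ke; exists k.
    exists k; split => // y Fy; rewrite leNgt; apply/negP => xy.
    by apply: (xe y) => //; rewrite -ball_normE /=; exact: lt_trans ke.
  have [xm|nxm] := pselect (far m.+1 x); first by left.
  right; move: xk; elim: k => [x0|k ih].
    by exfalso; apply: nxm; exact: far_le x0.
  move=> xk1; have [/ih//|nxk] := pselect (far k x).
  have mk : (m.+1 < k.+1)%N.
    by rewrite ltnNge; apply/negP => km; apply: nxm; exact: far_le xk1.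
  case: k {ih} xk1 nxk mk => // k xk1 nxk mk.
  by exists k => //=; apply/negP; rewrite -leqNgt.
have Ffin : H (X `&` F) \is a fin_num by apply: fin; exact: subIsetl.
rewrite addeC -leeBrDr//; apply/lee_addgt0Pr => e e0.
have [m me] := cvge0_le tail e0.
apply: le_trans (XF_le m) _; apply: leeD => //.
by rewrite leeBrDr.
Qed.

Lemma borel_caratheodory (A : set E) : measurable A -> H.-caratheodory A.
Proof.
move=> mA; have : <<s @open E >> `<=` (H.-caratheodory : set (set E)).
  apply: smallest_sub => [|B oB].
    split; first exact: caratheodory_measurable_set0.
      by move=> B /caratheodory_measurable_setC; rewrite setTD.
    by move=> G mG; exact: caratheodory_measurable_bigcup.
  rewrite -[B]setCK; apply: caratheodory_measurable_setC.
  by apply: closed_caratheodory; exact: open_closedC.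
exact.
Qed.

Let hausdorff_semi_sigma_additive : semi_sigma_additive H.
Proof.
move=> F mF tF mUF.
apply: (@caratheodory_measure_sigma_additive R E (H : {outer_measure set E -> \bar R})) => //.
  by move=> k; exact: borel_caratheodory.
exact: borel_caratheodory.
Qed.

HB.instance Definition _ := isMeasure.Build _ E R H
  (outer_measure0 _) (outer_measure_ge0 _) hausdorff_semi_sigma_additive.

End hausdorff_borel.

(** * Regularity of finite Borel measures *)

Section borel_regularity.
Context (R : realType) (n : nat).
Local Notation E := 'rV[R]_n.+1.
Implicit Types (A B C F O : set E).

Lemma open_measurable_rV O : open O -> measurable O.
Proof. exact: sub_sigma_algebra. Qed.

Lemma closed_measurable_rV C : closed C -> measurable C.
Proof.
by move=> cC; rewrite -[C]setCK; apply: measurableC; apply: open_measurable_rV; exact: closed_openC.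
Qed.

Context (mu : {measure set E -> \bar R}).
Hypothesis mu_fin : (mu setT < +oo)%E.

(** Complementation exchanges the roles of [C] and [O]; this symmetry is what makes the sets with
    this property a sigma-algebra. *)
Definition approximable A := forall e : R, 0 < e -> exists C O,
  [/\ closed C, open O, C `<=` A, A `<=` O & (mu (O `\` C) <= e%:E)%E].

Lemma mu_lty A : measurable A -> (mu A < +oo)%E.
Proof. by move=> mA; apply: le_lt_trans mu_fin; apply: le_measure; rewrite ?inE. Qed.

(** A closed set is the intersection of its decreasing neighbourhoods of width [k.+1%:R^-1];
    continuity from above applies as [mu] is finite. *)
Lemma closed_approximable C : closed C -> approximable C.
Proof.
move=> cC e e0.
pose O k := \bigcup_(y in C) ball y (k.+1%:R^-1 : R).
have oO k : open (O k) by apply: bigcup_open => y _; exact: ball_open.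
have CO k : C `<=` O k by move=> y Cy; exists y => //; apply: ballxx; rewrite invr_gt0.
have mOC k : measurable (O k `\` C).
  by apply: measurableD; [exact: open_measurable_rV | exact: closed_measurable_rV].
have O0 : \bigcap_k (O k `\` C) = set0.
  apply/seteqP; split => // x Ox.
  have nCx : (~` C) x by have [] := Ox 0%N I.
  have : nbhs x (~` C) by apply: open_nbhs_nbhs; split => //; exact: closed_openC.
  move=> /nbhs_ballP[r /= r0 xr].
  have [k kr] : exists k, (k.+1%:R^-1 < r)%R.
    have /cvgrPdist_lt/(_ _ r0) [k _ /(_ k (leqnn k))] := @cvg_harmonic R.
    by rewrite sub0r normrN /= ger0_norm ?invr_ge0// => kr; exists k.
  have [[y Cy yx] _] := Ox k I.
  by apply: (xr y) => //; apply: ball_sym; exact: le_ball (ltW kr) _ yx.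
have := @nonincreasing_cvg_mu _ _ _ mu (fun k => O k `\` C) (mu_lty (mOC 0%N)) mOC.
rewrite O0 measure0 => /(_ measurable0) cv.
have [|m me] := cvge0_le (cv _) e0.
  apply/nonincreasing_seqP => k; apply/subsetPset => x [[y Cy yx] nC]; split => //.
  by exists y => //; apply: le_ball yx; rewrite lef_pV2 ?posrE// ler_nat.
by exists C, (O m); split.
Qed.

Lemma approximableC A : approximable A -> approximable (~` A).
Proof.
move=> aA e e0; have [C [U [cC oU CA AU muCU]]] := aA e e0.
exists (~` U), (~` C); split.
- exact: open_closedC.
- exact: closed_openC.
- exact: subsetC.
- exact: subsetC.
- by rewrite setDE setCK setIC -setDE.
Qed.

(** A countable union of closed sets need not be closed, so it is truncated to the finite union
    [D m]. Continuity from above keeps this cost within half of [e]; the differences of [O k] and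
    [C k] share the other half. *)
Lemma approximable_bigcup (A : (set E)^nat) :
  (forall k, approximable (A k)) -> approximable (\bigcup_k A k).
Proof.
move=> aA e e0.
have e2 : 0 < e / 2 by rewrite divr_gt0.
have ek k : 0 < e / 2 / (2 ^ k.+1)%:R by rewrite divr_gt0// ltr0n expn_gt0.
have /choice[CO COP] : forall k, exists CO : set E * set E,
    [/\ closed CO.1, open CO.2, CO.1 `<=` A k, A k `<=` CO.2 &
        (mu (CO.2 `\` CO.1) <= (e / 2 / (2 ^ k.+1)%:R)%:E)%E].
  by move=> k; have [C [U ?]] := aA k _ (ek k); exists (C, U).
pose C k := (CO k).1; pose O k := (CO k).2.
have cC k : closed (C k) by have [] := COP k.
have oO k : open (O k) by have [] := COP k.
have mC k : measurable (C k) by exact: closed_measurable_rV.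
have mO k : measurable (O k) by exact: open_measurable_rV.
pose D m := \big[setU/set0]_(k < m) C k.
have cD m : closed (D m).
  by rewrite /D; elim/big_ind : _ => //; [exact: closed0 | exact: closedU].
have mCD : measurable (\bigcup_k C k) by exact: bigcupT_measurable.
pose F m := (\bigcup_k C k) `\` D m.
have mF m : measurable (F m) by apply: measurableD => //; exact: closed_measurable_rV.
have F0 : \bigcap_m F m = set0.
  apply/seteqP; split => // x Fx; have [[k _ Ckx] _] := Fx 0%N I.
  have [_] := Fx k.+1 I; apply; rewrite /D -bigcup_mkord; exists k => //=.
have := @nonincreasing_cvg_mu _ _ _ mu F (mu_lty (mF 0%N)) mF.
rewrite F0 measure0 => /(_ measurable0) cv.
have [|m me] := cvge0_le (cv _) e2.
  apply/nonincreasing_seqP => k; apply/subsetPset => x [Cx nD]; split => //.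
  by apply: contra_not nD => Dx; rewrite /D big_ord_recr/=; left.
exists (D m), (\bigcup_k O k); split => //.
- by apply: bigcup_open.
- rewrite /D -bigcup_mkord => x [k _ Ckx]; exists k => //.
  by have [_ _ CA _ _] := COP k; exact: CA.
- by move=> x [k _ Akx]; exists k => //; have [_ _ _ AO _] := COP k; exact: AO.
have mOC : measurable (\bigcup_k (O k `\` C k)).
  by apply: bigcupT_measurable => k; exact: measurableD.
apply: (@le_trans _ _ (mu (F m `|` \bigcup_k (O k `\` C k)))).
  apply: le_measure; rewrite ?inE.
  - by apply: measurableD; [apply: bigcupT_measurable | exact: closed_measurable_rV].
  - exact: measurableU.
  move=> x [[k _ Okx] nD]; have [Cx|nCx] := pselect ((\bigcup_k C k) x).
    by left.
  by right; exists k => //; split => // Ckx; apply: nCx; exists k.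
apply: le_trans (measureU2 mu (mF m) mOC) _.
rewrite [e]splitr EFinD; apply: leeD => //.
have mOCk k : measurable (O k `\` C k) by exact: measurableD.
apply: le_trans (measure_sigma_subadditive mu mOCk mOC (@subset_refl _ _)) _.
have h := epsilon_trick (A := fun=> 0%E : \bar R) xpredT (fun=> lexx _) (ltW e2).
move: h; rewrite [X in (_ <= X + _)%E -> _]eseries0// add0e => h.
apply: le_trans h; apply: lee_nneseries => k _ //; rewrite add0e.
by have [] := COP k.
Qed.

Lemma measurable_approximable A : measurable A -> approximable A.
Proof.
move=> mA; have : <<s @open E >> `<=` approximable.
  apply: smallest_sub => [|B oB].
    split; first by apply: closed_approximable; exact: closed0.
      by move=> B /approximableC; rewrite setTD.
    by move=> G mG; exact: approximable_bigcup.
  rewrite -[B]setCK; apply: approximableC; apply: closed_approximable.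
  exact: open_closedC.
exact.
Qed.

End borel_regularity.

(** * Boundary charts *)

Section chart.
Context (R : realType) (n : nat).
Local Notation E := 'rV[R]_n.+1.
Variable D : set E.
Hypothesis D_open : open D.

Lemma bd_closed : closed (bd D).
Proof.
by rewrite /bd setDE; apply: closedI; [exact: closed_closure | exact: open_closedC].
Qed.

(** A segment from [p] inside the ball is connected and misses the boundary, so its part in [D] is
    also its part in [closure D], hence open and closed in it. *)
Lemma ball_sub_open (p : E) (r : R) : D p ->
  (forall w, ball p r w -> ~ bd D w) -> ball p r `<=` D.
Proof.
move=> Dp nbd z pz.
pose S := [set p + t *: (z - p) | t in `[0, 1]%classic].
have ctS : connected S.
  apply: connected_continuous_connected; first exact: segment_connected.
  apply: continuous_subspaceT => t; apply: cvgD; first exact: cvg_cst.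
  by apply: cvgZr_tmp; exact: cvg_id.
have r0 : 0 < r by move: pz; rewrite -ball_normE /=; exact: le_lt_trans.
have Sball : S `<=` ball p r.
  move=> _ [t /= + <-]; rewrite in_itv/= => /andP[t0 t1].
  move: pz; rewrite -!ball_normE/= => pz.
  rewrite opprD addrA subrr sub0r normrN normrZ ger0_norm// distrC.
  by apply: le_lt_trans pz; rewrite ler_piMl.
have SD : S `&` D = S `&` closure D.
  apply/seteqP; split => x [Sx Dx]; split => //; first exact: subset_closure.
  by apply: contrapT => nDx; exact: (nbd _ (Sball _ Sx)).
have : S `&` D = S.
  apply: ctS.
  - by exists p; split => //; exists 0; rewrite ?scale0r ?addr0//= in_itv/= lexx ler01.
  - by exists D.
  - by exists (closure D) => //; exact: closed_closure.
have Sz : S z by exists 1; rewrite ?scale1r ?(addrC p) ?subrK//= in_itv/= lexx ler01.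
by move=> SDS; move: Sz; rewrite -SDS => -[].
Qed.

(** The parameter [y] of a boundary point is flat: with a positive last coordinate [psi y] would lie
    in [D], and with a negative one the points of [D] near [psi y] would also have parameters below
    the flat disc. [L] absorbs the ratio of the two norms. *)
Lemma boundary_chart (b : E) : bilipschitz_boundary D -> bd D b ->
  exists (psi : E -> E) (L rho : R),
  [/\ 1 <= L, 0 < rho,
      forall x y, eball 1 x -> eball 1 y ->
        `|psi x - psi y| <= L * `|x - y| /\ `|x - y| <= L * `|psi x - psi y|,
      forall x, eball 1 x -> 0 < x 0 ord_max -> D (psi x) &
      forall a, bd D a -> `|a - b| < rho ->
        exists y, [/\ eball 1 y, psi y = a, y 0 ord_max = 0 & `|y| <= L * `|a - b|]].
Proof.
move=> A1 bb; have [W [psi [bW [L0 L00 psiL] psiW psi0 psiD]]] := A1 b bb.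
have /nbhs_ballP[rho /= rho0 rhoW] := bW.
pose L := Num.max 1 (L0 * n.+1%:R).
have L1 : 1 <= L by rewrite le_max lexx.
have L0L : L0 * n.+1%:R <= L by rewrite le_max lexx orbT.
have lip x y : eball 1 x -> eball 1 y ->
    `|psi x - psi y| <= L * `|x - y| /\ `|x - y| <= L * `|psi x - psi y|.
  move=> x1 y1; have /andP[h1 h2] := psiL _ _ x1 y1; split.
    apply: le_trans (norm_le_enorm _) _; apply: le_trans h2 _.
    apply: le_trans (_ : _ <= L0 * (n.+1%:R * `|x - y|)) _.
      by rewrite ler_pM2l// enorm_le_norm.
    by rewrite mulrA ler_wpM2r.
  apply: le_trans (norm_le_enorm _) _; rewrite mulrC ler_pdivrMr// in h1.
  apply: le_trans h1 _; rewrite mulrC.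
  apply: le_trans (_ : _ <= L0 * (n.+1%:R * `|psi x - psi y|)) _.
    by rewrite ler_pM2l// enorm_le_norm.
  by rewrite mulrA ler_wpM2r.
have up x : eball 1 x -> 0 < x 0 ord_max -> D (psi x).
  move=> x1 x0; have : (psi @` upper_half 1) (psi x).
    exists x => //; split => // i /= iE; suff -> : i = ord_max by [].
    exact/val_inj.
  by rewrite psiD => -[].
have eball0 : eball 1 (0 : E).
  by apply: le_lt_trans (enorm_le_norm _) _; rewrite normr0 mulr0.
exists psi, L, rho; split => // a ba ab.
have aball : ball b rho a by rewrite -ball_normE/= distrC.
have : W a by exact: rhoW.
rewrite -psiW => -[y y1 ya]; exists y; split => //; last first.
  by have [_] := lip y 0 y1 eball0; rewrite psi0 ya subr0.
have [y0|y0|//] := ltrgtP (y 0 ord_max) 0; last first.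
  by case: ba => _; case; rewrite -ya; exact: up.
(* Within this distance of [a] the inverse chart moves the last coordinate by less than
   [- y 0 ord_max], so it stays negative. *)
have Ly0 : 0 < - y 0 ord_max / L by rewrite divr_gt0 ?oppr_gt0// (lt_le_trans _ L1).
have [x [Dx [ax Wx]]] : D `&` (ball a (- y 0 ord_max / L) `&` ball b rho) !=set0.
  apply: ba.1; apply: filterI; first exact: nbhsx_ballx.
  by apply: open_nbhs_nbhs; split => //; exact: ball_open.
have : (W `&` D) x by split => //; exact: rhoW.
rewrite -psiD => -[z [z1 /(_ ord_max erefl) z0] zx].
have [_] := lip y z y1 z1; rewrite ya zx => yz.
move: ax; rewrite -ball_normE/= ltr_pdivlMr ?(lt_le_trans _ L1)// mulrC => ax.
have := le_lt_trans yz ax; move=> /norm_rV_lt; rewrite oppr_gt0 => /(_ y0 ord_max).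
rewrite !mxE ltr_norml opprK => /andP[h _].
by have := lt_trans h (_ : y 0 ord_max - z 0 ord_max < y 0 ord_max); rewrite ltxx ltrBlDr ltrDl => /(_ z0).
Qed.

(** [p k] is the image of the point lying [4 * L * r] above the parameter of [a]. Flat parameters
    are at least that far from it, so boundary points in the chart stay [4 * r] away from [p k],
    leaving room for the radius [3 * r]; the upper Lipschitz bound gives [C = 4 * L ^+ 2]. *)
Lemma corkscrew (b : E) : bilipschitz_boundary D -> bd D b ->
  exists lam C sbar rho : R, [/\ 0 < lam < 1, 1 <= 2 * lam ^+ 2, 0 < C, 0 < sbar & 0 < rho] /\
  forall s a, 0 < s <= sbar -> bd D a -> `|a - b| < rho ->
  exists p : nat -> E, forall k, let r := (s * lam ^+ k) ^+ 2 in
  [/\ ball (p k) (3 * r) `<=` D, `|p k.+1 - p k| <= r & `|p k - a| <= C * r].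
Proof.
move=> A1 bb; have [psi [L [rho [L1 rho0 lip up flat]]]] := boundary_chart A1 bb.
have L0 : 0 < L by exact: lt_le_trans L1.
pose d : R := n.+1%:R.
have d1 : 1 <= d by rewrite ler1n.
have d0 : 0 < d by exact: lt_le_trans d1.
(* This makes [4 * L ^+ 2 * (1 - lam ^+ 2)] at most 1, and that factor times [r k] bounds the
   displacement from [p k] to [p k.+1]. *)
pose lam := 1 - (8 * L ^+ 2)^-1.
have lamE : 8 * L ^+ 2 * (1 - lam) = 1.
  by rewrite /lam; field; rewrite gt_eqF.
have lam0 : 0 < 1 - lam <= 8^-1.
  have L21 : 1 <= L ^+ 2 by rewrite exprn_ege1.
  have h : 0 < (8 * L ^+ 2)^-1 by rewrite invr_gt0; lra.
  rewrite /lam opprB addrC subrK h/= lef_pV2 ?posrE//; lra.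
have lam2 : 4 * L ^+ 2 * (1 - lam ^+ 2) <= 1.
  rewrite -[leRHS]lamE; have -> : 1 - lam ^+ 2 = (1 - lam) * (1 + lam) by ring.
  have l0 : 0 <= L ^+ 2 * (1 - lam) by rewrite mulr_ge0 ?sqr_ge0//; lra.
  have l1 : (L ^+ 2 * (1 - lam)) * (1 + lam) <= (L ^+ 2 * (1 - lam)) * 2.
    by rewrite ler_wpM2l//; lra.
  rewrite -!mulrA; rewrite -!mulrA in l1; lra.
(* The bound 1 gives [r k <= s]; the next keeps boundary points near [p k] within the chart; the
   last keeps [q k] in the unit ball. *)
pose sbar := Num.min 1 (Num.min (rho / (16 * L ^+ 2)) (16 * L * d)^-1).
have sbar0 : 0 < sbar.
  by rewrite !lt_min ltr01 divr_gt0 ?invr_gt0 ?mulr_gt0 ?exprn_gt0.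
pose rho' := Num.min (rho / 2) (4 * d * L)^-1.
have rho'0 : 0 < rho' by rewrite lt_min divr_gt0 ?invr_gt0 ?mulr_gt0.
exists lam, (4 * L ^+ 2), sbar, rho'; split.
  split => //; [lra | nra | by rewrite mulr_gt0 ?exprn_gt0].
move=> s a /andP[s0 sle] ba ab.
have ab1 : `|a - b| < rho / 2 by apply: lt_le_trans ab _; rewrite ge_min lexx.
have ab2 : `|a - b| < (4 * d * L)^-1 by apply: lt_le_trans ab _; rewrite ge_min lexx orbT.
have [y [y1 ya y0 yL]] : exists y, [/\ eball 1 y, psi y = a, y 0 ord_max = 0 & `|y| <= L * `|a - b|].
  by apply: flat => //; apply: lt_trans ab1 _; lra.
have s1 : s <= 1 by apply: le_trans sle _; rewrite ge_min lexx.
have s2 : s * (16 * L ^+ 2) <= rho.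
  rewrite -ler_pdivlMr ?mulr_gt0 ?exprn_gt0//; apply: le_trans sle _.
  by rewrite !ge_min lexx orbT.
have s3 : s * (16 * L * d) <= 1.
  rewrite -ler_pdivlMr ?mulr_gt0//; apply: le_trans sle _.
  by rewrite div1r !ge_min lexx !orbT.
have [r rE] : exists r : nat -> R, forall k, r k = (s * lam ^+ k) ^+ 2 by exists (fun k => (s * lam ^+ k) ^+ 2).
have r0 k : 0 < r k by rewrite rE exprn_gt0// mulr_gt0// exprn_gt0//; lra.
have rs k : r k <= s.
  rewrite rE exprMn expr2 -mulrA ler_piMr//; first exact: ltW.
  rewrite mulr_ile1//; [exact: ltW | by rewrite sqr_ge0 | ].
  by rewrite -exprM exprn_ile1//; lra.
have rS k : r k.+1 = lam ^+ 2 * r k by rewrite !rE [lam ^+ k.+1]exprS; ring.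
pose e : E := delta_mx 0 ord_max.
have enorm1 : `|e| <= 1.
  by apply/norm_rV_le => // i; rewrite mxE; case: (_ && _); rewrite ?normr1 ?normr0.
pose q k := y + (4 * L * r k) *: e.
have qe k : q k 0 ord_max = 4 * L * r k by rewrite !mxE y0 !eqxx mulr1 add0r.
have q1 k : eball 1 (q k).
  apply: le_lt_trans (enorm_le_norm _) _; rewrite -/d.
  apply: le_lt_trans (_ : _ <= d * (L * `|a - b| + 4 * L * s)) _.
    rewrite ler_pM2l//; apply: le_trans (ler_normD _ _) _; apply: lerD => //.
    rewrite normrZ gtr0_norm ?mulr_gt0//.
    apply: le_trans (_ : _ <= (4 * L * r k) * 1) _; first by rewrite ler_pM2l ?mulr_gt0.
    by rewrite mulr1 ler_pM2l ?mulr_gt0.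
  rewrite mulrDr; have h : d * (L * `|a - b|) < 4^-1.
    have : `|a - b| * (4 * d * L) < 1 by rewrite -ltr_pdivlMr ?mulr_gt0// div1r.
    by rewrite (_ : _ * (4 * d * L) = 4 * (d * (L * `|a - b|))); [lra | ring].
  have h' : d * (4 * L * s) <= 4^-1.
    by rewrite (_ : s * (16 * L * d) = 4 * (d * (4 * L * s))) in s3; [lra | ring].
  lra.
exists (fun k => psi (q k)) => k /=; rewrite -rE; split; last first.
- rewrite -ya; have [h _] := lip _ _ (q1 k) y1; apply: le_trans h _.
  rewrite /q addrC addKr normrZ gtr0_norm ?mulr_gt0// expr2.
  rewrite (_ : 4 * (L * L) * r k = L * ((4 * L * r k) * 1)); last by ring.
  by rewrite ler_pM2l// ler_pM2l// mulr_gt0 ?mulr_gt0.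
- have [h _] := lip _ _ (q1 k.+1) (q1 k); apply: le_trans h _.
  rewrite /q opprD addrACA subrr add0r -scalerBl normrZ rS.
  rewrite (_ : _ - _ = - (4 * L * (1 - lam ^+ 2) * r k)); last by ring.
  have l20 : 0 <= 1 - lam ^+ 2 by nra.
  rewrite normrN ger0_norm; last by rewrite !mulr_ge0 ?(ltW L0) ?(ltW (r0 k)).
  apply: le_trans (_ : _ <= L * ((4 * L * (1 - lam ^+ 2) * r k) * 1)) _.
    rewrite ler_pM2l// ler_wpM2l// !mulr_ge0 ?(ltW L0) ?(ltW (r0 k))//.
  rewrite (_ : L * _ = (4 * L ^+ 2 * (1 - lam ^+ 2)) * r k); last by ring.
  by rewrite ler_piMl// ltW.
apply: ball_sub_open; first by apply: up => //; rewrite qe !mulr_gt0.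
(* A boundary point [w] in the ball would have a flat parameter [v], at least [4 * L * r k] away
   from [q k], while the chart allows less than [3 * L * r k]. *)
move=> w pw bw; move: pw; rewrite -ball_normE/= => pw.
have [|v [v1 vw v0 _]] := flat w bw.
  have [h _] := lip _ _ (q1 k) y1.
  have h2 : `|psi (q k) - psi y| <= 4 * L ^+ 2 * r k.
    apply: le_trans h _; rewrite /q addrC addKr normrZ gtr0_norm ?mulr_gt0// expr2.
    rewrite (_ : 4 * (L * L) * r k = L * ((4 * L * r k) * 1)); last by ring.
    by rewrite ler_pM2l// ler_pM2l// mulr_gt0 ?mulr_gt0.
  rewrite ya in h2.
  have t1 := ler_distD (psi (q k)) w b; have t2 := ler_distD a (psi (q k)) b.
  rewrite distrC in pw.
  have L21 : 1 <= L ^+ 2 by rewrite exprn_ege1.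
  have h3 : L ^+ 2 * r k <= L ^+ 2 * s by rewrite ler_wpM2l// sqr_ge0.
  have h4 : r k <= L ^+ 2 * r k by rewrite ler_peMl// ltW.
  lra.
have [_] := lip _ _ (q1 k) v1; rewrite vw => h.
have h' : 4 * L * r k <= `|q k - v|.
  have /norm_rV_le := lexx `|q k - v|; rewrite normr_ge0 => /(_ isT ord_max).
  by rewrite mxE [(- v) _ _]mxE qe v0 subr0 ger0_norm// !mulr_ge0 ?ltW.
have : L * `|psi (q k) - w| < L * (3 * r k) by rewrite ltr_pM2l.
have : 0 < L * r k by rewrite mulr_gt0.
by rewrite mulrCA => ? ?; rewrite -mulrA in h'; lra.
Qed.

End chart.

(** * The surface measure is Radon *)

Section outer_measure_extra.
Context (R : realType).

Lemma outer_measure_seq (T I : Type) (mu : {outer_measure set T -> \bar R})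
    (s : seq I) (U : I -> set T) :
  (mu (\big[setU/set0]_(i <- s) U i) <= \sum_(i <- s) mu (U i))%E.
Proof.
elim: s => [|i s ih]; first by rewrite !big_nil outer_measure0.
rewrite !big_cons; apply: le_trans (outer_measureU2 _ _ _) _.
exact: leeD2l.
Qed.

Lemma outer_measure_finType (T : Type) (I : finType) (mu : {outer_measure set T -> \bar R})
    (A : set T) (U : I -> set T) :
  A `<=` \bigcup_i U i -> (mu A <= \sum_i mu (U i))%E.
Proof.
move=> AU; apply: le_trans (outer_measure_seq _ _ _); apply: le_outer_measure => x /AU[i _ Uix].
by rewrite -bigcup_seq; exists i => //=; exact: mem_index_enum.
Qed.

Lemma hausdorff_pre0_pos d s (delta : {posnum R}) :
  hausdorff_pre s delta%:num (@set0 'rV[R]_d) = 0%E.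
Proof. exact: hausdorff_pre0. Qed.

HB.instance Definition _ (d s : nat) (delta : {posnum R}) :=
  isOuterMeasure.Build R 'rV[R]_d (hausdorff_pre s delta%:num)
    (hausdorff_pre0_pos d s delta) (hausdorff_pre_ge0 s delta%:num)
    (@le_hausdorff_pre R d s delta%:num)
    (@hausdorff_pre_sigma_subadditive R d s delta%:num).

End outer_measure_extra.

Section local_finiteness.
Context (R : realType) (n : nat).
Local Notation E := 'rV[R]_n.+1.

(** Induction over a finite subcover, used both for finiteness of the surface measure and for its
    vanishing on null sets. *)
Lemma compact_local (K : set E) (P : set E -> Prop) : compact K -> P set0 ->
  (forall A B, A `<=` B -> P B -> P A) -> (forall A B, P A -> P B -> P (A `|` B)) ->
  (forall x, K x -> exists2 r : R, 0 < r & P (K `&` ball x r)) -> P K.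
Proof.
move=> cK P0 PS PU Kloc.
have /choice[r rP] : forall x, exists r : R, K x -> 0 < r /\ P (K `&` ball x r).
  move=> x; have [/Kloc[r r0 Pr]|nKx] := pselect (K x); first by exists r.
  by exists 0.
move: cK; rewrite compact_cover => /(_ E K (fun x => ball x (r x))) [].
- by move=> x Kx; exact: ball_open.
- by move=> x Kx; exists x => //; apply: ballxx; exact: (rP x Kx).1.
move=> F FK KF; apply: (@PS _ (\big[setU/set0]_(x <- finmap.enum_fset F) (K `&` ball x (r x)))).
  move=> x Kx; have [y yF yx] := KF x Kx.
  by rewrite -bigcup_seq; exists y.
rewrite big_seq_cond; elim/big_ind : _ => // x; rewrite andbT => xF.
by have := FK x xF; rewrite inE => /rP[].
Qed.

(** The disc is cut into [N.+1 ^ n] cells with images of diameter at most [c / N.+1]; the total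
    [c ^+ n] does not depend on [N], so the bound survives as [delta] tends to 0. *)
Lemma flat_hausdorff (psi : E -> E) (L : R) : 1 <= L ->
  (forall x y, eball 1 x -> eball 1 y -> `|psi x - psi y| <= L * `|x - y|) ->
  (hausdorff n (psi @` [set y : E | (eball 1 y /\ y 0 ord_max = 0)%R]) <=
   ((2 * n.+1%:R * L) ^+ n)%:E)%E.
Proof.
move=> L1 lip; have L0 : 0 < L by exact: lt_le_trans L1.
pose c : R := 2 * n.+1%:R * L.
have c0 : 0 < c by rewrite !mulr_gt0.
apply: hausdorff_le => delta d0.
have [N Nd] : exists N : nat, c / N.+1%:R <= delta.
  exists (Num.truncn (c / delta)).
  rewrite ler_pdivrMr// mulrC -ler_pdivrMr//.
  exact/ltW/(truncnS_gt (c / delta)).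
(* Only the [n] coordinates other than the last are subdivided, after an affine map from [(-1, 1)]
   onto [(0, N.+1)]. *)
pose cell (z : {ffun 'I_n -> 'I_N.+1}) : set E := [set y | [/\ eball 1 y, y 0 ord_max = 0 &
  forall j : 'I_n, (z j)%:R <= N.+1%:R * (y 0 (lift ord_max j) + 1) / 2 <= (z j)%:R + 1]].
have cellP z x y : (psi @` cell z) x -> (psi @` cell z) y -> enorm (x - y) <= c / N.+1%:R.
  move=> [u [u1 u0 uz] <-] [v [v1 v0 vz] <-].
  apply: le_trans (enorm_le_norm _) _.
  rewrite (_ : c / _ = n.+1%:R * (L * (2 / N.+1%:R))); last by rewrite /c; ring.
  rewrite ler_pM2l//; apply: le_trans (lip _ _ u1 v1) _; rewrite ler_pM2l//.
  apply/norm_rV_le => [|i]; first by rewrite divr_ge0.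
  rewrite !mxE; have [j ->|->] := unliftP ord_max i; last first.
    by rewrite u0 v0 subrr normr0 divr_ge0.
  have := uz j; have := vz j.
  set U := u 0 _; set V := v 0 _; set N' := N.+1%:R : R => /andP[h1 h2] /andP[h3 h4].
  rewrite ler_pdivlMr// -[X in _ * X]ger0_norm// -normrM.
  rewrite (_ : _ * N' = 2 * (N' * (U + 1) / 2 - N' * (V + 1) / 2)); last by field.
  by rewrite ler_norml; lra.
have := @outer_measure_finType R E _ (hausdorff_pre n (PosNum d0)%:num)
  (psi @` [set y : E | eball 1 y /\ y 0 ord_max = 0]) (fun z => psi @` cell z).
move=> /(_ _)/le_trans -> //.
  move=> _ [y [y1 y0] <-].
  pose t j := N.+1%:R * (y 0 (lift ord_max j) + 1) / 2.
  have y11 j : -1 < y 0 (lift ord_max j) < 1.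
    rewrite -ltr_norml; apply: le_lt_trans y1; exact: le_coord_enorm.
  have t0 j : 0 <= t j.
    by rewrite /t divr_ge0// mulr_ge0//; have := y11 j; lra.
  have tN j : (Num.truncn (t j) < N.+1)%N.
    rewrite truncn_lt_nat//= /t ltr_pdivrMr// ltr_pM2l//; have := y11 j; lra.
  exists [ffun j => Ordinal (tN j)] => //; exists y => //; split => // j.
  rewrite ffunE/= -/(t j); have := truncn_itv (t0 j).
  by move=> /andP[-> /ltW]; rewrite -natr1.
apply: (@le_trans _ _ (\sum_(z : {ffun 'I_n -> 'I_N.+1}) ((c / N.+1%:R) ^+ n)%:E)%E).
  apply: lee_sum => z _; apply: le_trans (hausdorff_pre_le_gauge _ _ _) _.
  - by [].
  - by apply: ediam_le => x y xz yz; exact: le_trans (cellP z x y xz yz) Nd.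
  - by apply: hausdorff_gauge_le; [rewrite divr_ge0 ?ltW | exact: cellP].
rewrite sumEFin sumr_const card_ffun !card_ord lee_fin -[leLHS]mulr_natr expr_div_n natrX.
by rewrite divfK// expf_neq0.
Qed.

Lemma bd_locally_finite (D : set E) (b : E) : bilipschitz_boundary D -> bd D b ->
  exists2 r : R, 0 < r & (hausdorff n (bd D `&` ball b r) < +oo)%E.
Proof.
move=> A1 bb; have [psi [L [rho [L1 rho0 lip up flat]]]] := boundary_chart A1 bb.
exists rho => //; apply: (@le_lt_trans _ _ (((2 * n.+1%:R * L) ^+ n)%:E)%E); last exact: ltry.
apply: le_trans (flat_hausdorff L1 (fun x y x1 y1 => (lip x y x1 y1).1)).
apply: le_outer_measure => a [ba]; rewrite -ball_normE/= distrC => ab.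
by have [y [y1 ya y0 _]] := flat a ba ab; exists y.
Qed.

Lemma bd_compact_finite (D K : set E) : bilipschitz_boundary D -> compact K -> K `<=` bd D ->
  (hausdorff n K < +oo)%E.
Proof.
move=> A1 cK KD; apply: (compact_local (P := fun A => (hausdorff n A < +oo)%E)) cK _ _ _ _.
- by rewrite outer_measure0.
- by move=> A B AB; apply: le_lt_trans; exact: le_outer_measure.
- by move=> A B Aoo Boo; apply: le_lt_trans (outer_measureU2 _ _ _) _; exact: lte_add_pinfty.
move=> x Kx; have [r r0 rfin] := bd_locally_finite A1 (KD _ Kx).
exists r => //; apply: le_lt_trans rfin; apply: le_outer_measure.
exact: setSI.
Qed.

Definition cube (m : nat) : set E := [set v | forall i, `[- m%:R, m%:R]%classic (v ord0 i)].

Lemma cube_compact m : compact (cube m).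
Proof.
have h : forall i : 'I_n.+1, compact `[- (m%:R : R), m%:R]%classic by move=> i; exact: segment_compact.
exact: (rV_compact h).
Qed.

Lemma cube_cover (x : E) : exists m, cube m x.
Proof.
exists (Num.truncn `|x|).+1 => i /=; rewrite in_itv/= -ler_norml.
apply: le_trans (ltW (truncnS_gt _)).
by have /norm_rV_le := lexx `|x|; apply.
Qed.

Lemma radon_surface (D : set E) : open D -> bilipschitz_boundary D ->
  radon_on (bd D) (surface D).
Proof.
move=> oD A1; have cbd := bd_closed oD.
pose H : {measure set E -> \bar R} := hausdorff n.
have mbd : measurable (bd D) by exact: closed_measurable_rV.
have mtr A : strace measurable (bd D) A -> measurable A /\ A `<=` bd D.
  by move=> [G mG <-]; split; [exact: measurableI | exact: subIsetr].
have surfE A : A `<=` bd D -> surface D A = hausdorff n A.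
  by move=> AD; rewrite /surface (setIidl AD).
split.
- split => [|A _]; first by rewrite /surface set0I outer_measure0.
  exact: outer_measure_ge0.
- move=> F mF tF; rewrite surfE; last by move=> x [k _]; exact: (mtr _ (mF k)).2.
  rewrite (measure_semi_bigcup H (fun k => (mtr _ (mF k)).1) tF); last first.
    by apply: bigcupT_measurable => k; exact: (mtr _ (mF k)).1.
  by apply: eq_eseriesr => k _; rewrite surfE//; exact: (mtr _ (mF k)).2.
- by move=> K cK KD; rewrite surfE//; exact: (bd_compact_finite A1 cK KD).
move=> A /mtr[mA AD]; rewrite surfE//.
set S := ereal_sup _; apply/eqP; rewrite eq_le; apply/andP; split; last first.
  apply: ge_ereal_sup => _ [K [cK KA] <-].
  by rewrite surfE; [exact: le_outer_measure | exact: subset_trans AD].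
(* The surface measure of [A] may be infinite. Each bounded piece lies in a compact part [K] of the
   boundary, to which the measure restricts as a finite one; a monotone limit recovers [A]. *)
pose B m := A `&` cube m.
have cE (K : set E) : compact K -> closed K.
  by move=> cK; apply: compact_closed => //; exact: norm_hausdorff.
have mcube m : measurable (cube m) by apply: closed_measurable_rV; apply: cE; exact: cube_compact.
have mB m : measurable (B m) by exact: measurableI.
have AB : \bigcup_m B m = A.
  apply/seteqP; split => [x [m _ []]//|x Ax].
  by have [m xm] := cube_cover x; exists m.
have ndB : nondecreasing_seq B.
  apply/nondecreasing_seqP => m; apply/subsetPset => x [Ax xm]; split => // i.
  have := xm i; rewrite /= !in_itv/= -!ler_norml => /le_trans; apply.
  by rewrite ler_nat.
have mUB : measurable (\bigcup_m B m) by exact: bigcupT_measurable.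
have cv := @nondecreasing_cvg_mu _ _ _ H B mB mUB ndB.
rewrite AB in cv; rewrite -(cvg_lim (@ereal_hausdorff R) cv).
apply: lime_le; first exact: cvgP cv.
apply: nearW => m /=; apply/lee_addgt0Pr => e e0.
pose K := cube m `&` bd D.
have cK : compact K by apply: compact_closedI => //; exact: cube_compact.
have mK : measurable K by apply: closed_measurable_rV; exact: cE.
have Kfin : (mrestr H mK setT < +oo)%E.
  by rewrite /mrestr setTI; apply: (bd_compact_finite A1 cK); exact: subIsetr.
have [C [U [cC oU CB BU muCU]]] := measurable_approximable Kfin (mB m) e0.
have BK : B m `<=` K by move=> x [Ax xm]; split => //; exact: AD.
have mC : measurable C by exact: closed_measurable_rV.
have cC' : compact C by apply: subclosed_compact cK _ => //; exact: subset_trans BK.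
apply: (@le_trans _ _ (H (C `|` (B m `\` C)))).
  by apply: le_outer_measure => x Bx; have [Cx|nCx] := pselect (C x); [left | right].
apply: le_trans (outer_measureU2 _ _ _) _; apply: leeD.
  apply: ereal_sup_ubound; exists C; first by split => // x /CB[].
  by rewrite surfE// => x /CB[/AD].
apply: le_trans muCU; rewrite /mrestr; apply: le_outer_measure => x [Bx nCx].
by split; [split => //; exact: BU | exact: BK].
Qed.

End local_finiteness.

(** * Smooth step and product test functions *)

Section smooth_real.
Context (R : realType).
Implicit Types f g : R -> R.

(** The derivatives are existential witnesses, so closure under products, inverses and affine
    substitutions is a plain induction on [k]. *)
Fixpoint ndiff (k : nat) f : Prop :=
  if k is k'.+1 then exists2 df, (forall x : R, is_derive x (1 : R) f (df x : R)) & ndiff k' df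
  else True.

Lemma ndiffW k f : ndiff k.+1 f -> ndiff k f.
Proof. by elim: k f => //= k ih f [df fdf] /ih; exists df. Qed.

Lemma ndiffD k f g : ndiff k f -> ndiff k g -> ndiff k (f \+ g).
Proof.
elim: k f g => //= k ih f g [df fdf kf] [dg gdg kg].
by exists (df \+ dg); [move=> x; exact: is_deriveD | exact: ih].
Qed.

Lemma ndiffM k f g : ndiff k f -> ndiff k g -> ndiff k (f \* g).
Proof.
elim: k f g => // k ih f g kf kg.
have /= [df fdf kdf] := kf; have /= [dg gdg kdg] := kg.
exists ((f \* dg) \+ (g \* df)).
  by move=> x; have := is_deriveM (fdf x) (gdg x).
by apply: ndiffD; apply: ih => //; exact: ndiffW.
Qed.

Lemma ndiffV k f : (forall x, f x != 0) -> ndiff k f -> ndiff k (fun x => (f x)^-1).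
Proof.
move=> f0; elim: k => // k ih kf; have /= [df fdf kdf] := kf.
exists (((fun x => (f x)^-1) \* (fun x => (f x)^-1)) \* ((fun=> -1) \* df)).
  move=> x; have dV := is_deriveV (f0 x) (fdf x); apply: is_derive_eq dV _.
  by rewrite /= mulN1r mulrN scaleNr expr2 invfM.
apply: ndiffM; first by apply: ndiffM; apply: ih; exact: ndiffW.
apply: ndiffM => //.
elim: k {ih kf kdf} (-1) => //= k ih c; exists (fun=> 0); last exact: ih.
by move=> x; exact: is_derive_cst.
Qed.

Lemma is_derive_affine (a b x : R) : is_derive x 1 (fun y => a * y + b) a.
Proof.
apply: is_derive_eq.
by rewrite addr0 -[LHS]/(_ * _) mulr1.
Qed.

Lemma ndiff_affine k f (a b : R) : ndiff k f -> ndiff k (fun x => f (a * x + b)).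
Proof.
elim: k f => // k ih f /= [df fdf kdf].
exists ((fun=> a) \* (fun x => df (a * x + b))).
  move=> x; rewrite [X in is_derive _ _ _ X]mulrC.
  exact: (is_derive1_comp (fdf _) (is_derive_affine a b x)).
apply: ndiffM; last exact: ih.
elim: k {ih kdf} a => //= k ih c; exists (fun=> 0); last exact: ih.
by move=> x; exact: is_derive_cst.
Qed.

(** A function packed with all its derivatives, so that differentiating means shifting the index. *)
Definition derivative_tower (u : nat -> R -> R) :=
  forall k (x : R), is_derive x (1 : R) (u k) (u k.+1 x).

Lemma ndiff_tower f : (forall k, ndiff k f) ->
  exists2 u, derivative_tower u & u 0%N = f.
Proof.
move=> fC; exists (fun k => iter k (@derive1 R R) f) => // k x.
have : ndiff 1 (iter k (@derive1 R R) f).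
  have : forall l, ndiff l (iter k (@derive1 R R) f).
    elim: k => //= k ih l; have /= [df fdf ldf] := ih l.+1.
    suff -> : derive1 (iter k (@derive1 R R) f) = df by [].
    by apply/funext => y; rewrite derive1E; exact: (derive_val (is_derive := fdf y)).
  exact.
move=> /= [df fdf _]; have := fdf x; suff -> : df x = derive1 (iter k (@derive1 R R) f) x by [].
by rewrite derive1E; apply/esym; exact: (derive_val (is_derive := fdf x)).
Qed.

End smooth_real.

Section bump.
Context (R : realType).

(** For [m = 0] the classical function vanishing to infinite order at 0; the powers of [x^-1] make
    the family stable under differentiation. *)
Definition flat (m : nat) (x : R) : R := if 0 < x then x^-1 ^+ m * expR (- x^-1) else 0.

Lemma flat_ge0 m x : 0 <= flat m x.
Proof.
rewrite /flat; case: ifPn => // x0.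
by rewrite mulr_ge0 ?exprn_ge0 ?expR_ge0// invr_ge0 ltW.
Qed.

Lemma flat_gt0 m x : 0 < x -> 0 < flat m x.
Proof. by move=> x0; rewrite /flat x0 mulr_gt0 ?exprn_gt0 ?expR_gt0// invr_gt0. Qed.

Lemma flat_eq0 m x : x <= 0 -> flat m x = 0.
Proof. by move=> x0; rewrite /flat ltNge x0. Qed.

(** One term of the exponential series at [x^-1] suffices; the linear bound serves for continuity at
    0. *)
Lemma flat_le m x : flat m x <= (m.+1)`!%:R * `|x|.
Proof.
rewrite /flat; case: ifPn => [x0|_]; last by rewrite mulr_ge0.
rewrite (gtr0_norm x0) expRN ler_pdivrMr ?expR_gt0//.
have y0 : 0 < x^-1 by rewrite invr_gt0.
have := expR_ge1Dxn m (ltW y0) => h.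
have {}h : x^-1 ^+ m.+1 / (m.+1)`!%:R <= expR x^-1 by apply: le_trans h; rewrite lerDr.
have f0 : 0 < (m.+1)`!%:R :> R by rewrite ltr0n fact_gt0.
rewrite ler_pdivrMr// in h.
have -> : x^-1 ^+ m = x^-1 ^+ m.+1 * x by rewrite exprSr mulfVK ?gt_eqF.
by rewrite mulrAC ler_pM2r// mulrC.
Qed.

Lemma is_derive_flat m (x : R) :
  is_derive x 1 (flat m) (flat m.+2 x - m%:R * flat m.+1 x).
Proof.
have [x0|x0|->] := ltrgtP x 0.
- rewrite !flat_eq0 ?ltW// mulr0 subr0; apply: near_eq_is_derive (is_derive_cst 0 x 1).
  near=> y; rewrite flat_eq0//; apply: ltW; near: y; exact: lt_nbhsl.
- have xn0 : x != 0 by rewrite gt_eqF.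
  have dV : is_derive x 1 (fun y : R => y^-1) (- x ^- 2).
    have dV := is_deriveV xn0 (is_derive_id x 1); apply: is_derive_eq dV _.
    by rewrite -[LHS]/(_ * _) mulr1.
  have dX := is_deriveX m dV.
  have dE : is_derive x 1 (fun y : R => expR (- y^-1)) (expR (- x^-1) * x ^- 2).
    have dN : is_derive x 1 (fun y : R => - y^-1) (x ^- 2).
      by have := is_deriveN dV; rewrite opprK.
    exact: (is_derive1_comp (is_derive_expR _) dN).
  have dM : is_derive x 1 (flat m) (x^-1 ^+ m *: (expR (- x^-1) * x ^- 2) +
      expR (- x^-1) *: ((m%:R * x^-1 ^+ m.-1) *: (- x ^- 2))).
    have := is_deriveM dX dE; rewrite !fctE => h; apply: near_eq_is_derive h.
    by near=> y; rewrite /flat ifT//; near: y; exact: lt_nbhsr.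
  apply: is_derive_eq dM _.
  rewrite /flat x0 /GRing.scale /= -exprVn.
  case: m {dX} => [|m] /=; first by rewrite !mul0r mulr0 addr0 subr0 expr0; ring.
  by rewrite !exprS; ring.
- rewrite !flat_eq0// mulr0 subr0; apply/is_derive1_caratheodory.
  (* Since [flat m x = flat m.+1 x * x], the difference quotient at 0 is [flat m.+1] itself. *)
  exists (flat m.+1); split.
  + move=> z; rewrite (flat_eq0 _ (lexx 0)) !subr0 /flat; case: ifPn => [z0|_].
      by rewrite exprSr mulrAC mulfVK// gt_eqF.
    by rewrite mul0r.
  + apply/cvgrPdist_le => e e0; rewrite flat_eq0//.
    have c0 : 0 < (m.+2)`!%:R :> R by rewrite ltr0n fact_gt0.
    have ec0 : 0 < e / (m.+2)`!%:R by rewrite divr_gt0.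
    apply/nbhs_ballP; exists (e / (m.+2)`!%:R) => //= y.
    rewrite /ball/= sub0r normrN => /ltW ye.
    rewrite sub0r normrN ger0_norm ?flat_ge0//.
    by apply: le_trans (flat_le _ _) _; rewrite mulrC -ler_pdivlMr.
  + by rewrite flat_eq0.
Unshelve. all: by end_near. Qed.

Lemma ndiff_flat k m : ndiff k (flat m).
Proof.
elim: k m => // k ih m; exists (flat m.+2 \+ ((fun=> - m%:R) \* flat m.+1)).
  by move=> x; rewrite /= mulNr; exact: is_derive_flat.
apply: ndiffD => //; apply: ndiffM => //.
elim: k {ih} (- m%:R) => //= k ih c; exists (fun=> 0); last exact: ih.
by move=> x; exact: is_derive_cst.
Qed.

Definition denom (x : R) := flat 0 x + flat 0 (1 - x).

Lemma denom_gt0 x : 0 < denom x.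
Proof.
rewrite /denom; have [x0|x0] := ltP 0 x.
  by rewrite ltr_wpDr ?flat_ge0 ?flat_gt0.
by rewrite ltr_wpDl ?flat_ge0 ?flat_gt0// subr_gt0 (le_lt_trans x0).
Qed.

Definition step (x : R) := flat 0 x * (denom x)^-1.

Lemma step_le0 x : x <= 0 -> step x = 0.
Proof. by move=> x0; rewrite /step flat_eq0 ?mul0r. Qed.

Lemma step_ge1 x : 1 <= x -> step x = 1.
Proof.
move=> x1; have := denom_gt0 x; rewrite /step /denom [flat 0 (1 - x)]flat_eq0 ?subr_le0// addr0.
by move=> x0; rewrite divff// gt_eqF.
Qed.

Lemma step01 x : 0 <= step x <= 1.
Proof.
have d0 := denom_gt0 x; rewrite /step divr_ge0 ?flat_ge0 ?(ltW d0)//=.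
by rewrite ler_pdivrMr// mul1r /denom lerDl flat_ge0.
Qed.

Lemma flat1B : (fun x => flat 0 (1 - x)) = (fun x => flat 0 (-1 * x + 1)).
Proof. by apply/funext => x; rewrite mulN1r addrC. Qed.

Lemma is_derive_denom (x : R) : is_derive x 1 denom (flat 2 x - flat 2 (1 - x)).
Proof.
apply: is_deriveD; first by have := is_derive_flat 0 x; rewrite mul0r subr0.
rewrite flat1B; have := is_derive_flat 0 (-1 * x + 1); rewrite mul0r subr0 => d1.
have := @is_derive1_comp R (flat 0) (fun y => -1 * y + 1) x _ _ d1 (is_derive_affine (-1) 1 x).
by rewrite mulrN1 [-1 * x + 1]addrC mulN1r.
Qed.

Lemma ndiff_step k : ndiff k step.
Proof.
apply: ndiffM; first exact: ndiff_flat.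
apply: ndiffV => [x|]; first by rewrite gt_eqF ?denom_gt0.
apply: ndiffD; first exact: ndiff_flat.
by rewrite flat1B; apply: ndiff_affine; exact: ndiff_flat.
Qed.

(** Written this way, the sign, the support and the positivity of the derivative on [(0, 1)] can be
    read off. *)
Lemma is_derive_step (x : R) : is_derive x 1 step
  ((flat 2 x * flat 0 (1 - x) + flat 0 x * flat 2 (1 - x)) / denom x ^+ 2).
Proof.
have d0 : denom x != 0 by rewrite gt_eqF ?denom_gt0.
have dF := is_derive_flat 0 x; rewrite mul0r subr0 in dF.
have := is_deriveM dF (is_deriveV d0 (is_derive_denom x)) => dM.
apply: is_derive_eq dM _; rewrite /GRing.scale/=.
by rewrite /denom in d0 *; field.
Qed.

(** [u 0] is the step and [u 1] the bump of the kernels; [M] is the maximum of the bump and [c] its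
    minimum over the middle half of the unit interval. *)
Lemma smooth_step : exists (u : nat -> R -> R) (M c : R),
  [/\ derivative_tower u,
      [/\ forall x, x <= 0 -> u 0%N x = 0, forall x, 1 <= x -> u 0%N x = 1 &
          forall x, 0 <= u 0%N x <= 1],
      forall x, 0 <= u 1%N x <= M,
      forall x, (x <= 0) || (1 <= x) -> u 1%N x = 0 &
      0 < c /\ forall x, 4^-1 <= x <= 3 / 4 -> c <= u 1%N x].
Proof.
have [u du u0] := ndiff_tower ndiff_step.
have u1E x : u 1%N x =
    (flat 2 x * flat 0 (1 - x) + flat 0 x * flat 2 (1 - x)) / denom x ^+ 2.
  have := du 0%N x; rewrite u0 => d1.
  by rewrite -(derive_val (is_derive := d1)) (derive_val (is_derive := is_derive_step x)).
have u1_ge0 x : 0 <= u 1%N x.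
  by rewrite u1E divr_ge0 ?sqr_ge0// addr_ge0// mulr_ge0 ?flat_ge0.
have u1_eq0 x : (x <= 0) || (1 <= x) -> u 1%N x = 0.
  case/orP => x01; rewrite u1E; first by rewrite !(flat_eq0 _ x01) !mul0r addr0 mul0r.
  by rewrite -subr_le0 in x01; rewrite !(flat_eq0 _ x01) !mulr0 addr0 mul0r.
have u1c : continuous (u 1%N).
  by move=> x; apply/differentiable_continuous/derivable1_diffP; exact: (ex_derive (is_derive := du 1%N x)).
have [y _ yM] := EVT_max (@ler01 R) (continuous_subspaceT u1c).
have h13 : 4^-1 <= 3 / 4 :> R by lra.
have [z z14 zm] := EVT_min h13 (continuous_subspaceT u1c).
exists u, (u 1%N y), (u 1%N z); split => //.
- rewrite u0; split; [exact: step_le0|exact: step_ge1|exact: step01].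
- move=> x; rewrite u1_ge0/=; have [/andP[x0 x1]|] := boolP ((0 < x) && (x < 1)).
    by apply: yM; rewrite in_itv/= !ltW.
  by rewrite negb_and -!leNgt => /u1_eq0 ->.
- split => [|x x14]; last by apply: zm; rewrite in_itv.
  move: z14; rewrite in_itv/= => /andP[z1 z2]; rewrite u1E divr_gt0 ?exprn_gt0 ?denom_gt0//.
  by rewrite ltr_wpDr ?mulr_ge0 ?flat_ge0// mulr_gt0// flat_gt0//; lra.
Qed.

End bump.

Section tower_operations.
Context (R : realType).
Implicit Types u v : nat -> R -> R.

Lemma derivative_towerS u : derivative_tower u -> derivative_tower (fun k => u k.+1).
Proof. by move=> du k x; exact: du. Qed.

Lemma derivative_towerB u v : derivative_tower u -> derivative_tower v ->
  derivative_tower (fun k => u k \- v k).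
Proof. by move=> du dv k x; exact: is_deriveB. Qed.

(** The tower of [u 0] evaluated at [(x - p) / r]. For the step, level 1 is a bump of integral 1 on
    [[p, p + r]]: [p] is an endpoint, not the centre. *)
Definition rescale u (p r : R) (k : nat) (x : R) := r^-1 ^+ k * u k (r^-1 * x + (- p / r)).

Lemma derivative_tower_rescale u p r : derivative_tower u -> derivative_tower (rescale u p r).
Proof.
move=> du k x.
have d1 := @is_derive1_comp R (u k) (fun y => r^-1 * y + (- p / r)) x _ _
  (du k _) (is_derive_affine r^-1 (- p / r) x).
have d2 := is_deriveZ (r^-1 ^+ k) d1; apply: is_derive_eq d2 _.
by rewrite /rescale /GRing.scale/= exprSr [u k.+1 _ * _]mulrC mulrA.
Qed.

End tower_operations.

Section tensor.
Context (R : realType) (d : nat) (u : 'I_d -> nat -> R -> R).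
Hypothesis du : forall j, derivative_tower (u j).

(** [al] is a multi-index of derivatives: partial derivatives of a tensor are again tensors, which
    settles smoothness of all orders at once. *)
Definition tensor (al : 'I_d -> nat) (x : 'rV[R]_d) := \prod_j u j (al j) (x 0 j).

Lemma tensor_continuous al : continuous (tensor al).
Proof.
rewrite /tensor; elim: (index_enum _) => [|j s ih].
  by under eq_fun do rewrite big_nil; exact: cst_continuous.
under eq_fun do rewrite big_cons.
move=> x; apply: (@continuousM R 'rV[R]_d); last exact: ih.
have uj : continuous (u j (al j)).
  by move=> y; apply/differentiable_continuous/derivable1_diffP; exact: (ex_derive (is_derive := du j (al j) y)).
exact: continuous_comp (@coord_continuous R 1 d 0 j x) (uj _).
Qed.

Definition incr (al : 'I_d -> nat) i j := if j == i then (al j).+1 else al j.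

Lemma is_derive_tensor al i x :
  is_derive x (delta_mx 0 i) (tensor al) (tensor (incr al i) x).
Proof.
pose C := \prod_(j | j != i) u j (al j) (x 0 j).
have dui := du i (al i) (x 0 i).
have G : h^-1 *: ((u i (al i) \o shift (x 0 i)) (h *: (1 : R)) - u i (al i) (x 0 i))
    @[h --> (0:R)^'] --> u i (al i).+1 (x 0 i).
  rewrite -[X in _ --> X](derive_val (is_derive := dui)).
  exact: (ex_derive (is_derive := dui)).
have F : h^-1 *: ((tensor al \o shift x) (h *: delta_mx 0 i) - tensor al x)
    @[h --> (0:R)^'] --> tensor (incr al i) x.
  rewrite (_ : tensor (incr al i) x = C * u i (al i).+1 (x 0 i)); last first.
    rewrite /tensor (bigD1 i)//= /incr eqxx mulrC; congr (_ * _).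
    by apply: eq_bigr => j /negbTE ->.
  rewrite (_ : (fun h : R => _) = (fun h : R => C *
      (h^-1 *: ((u i (al i) \o shift (x 0 i)) (h *: (1 : R)) - u i (al i) (x 0 i))))).
    exact: cvgMr.
  apply/funext => h; rewrite /tensor /= (bigD1 i)//= [X in _ - X](bigD1 i)//=.
  rewrite !mxE !eqxx/= /GRing.scale/= mulr1.
  rewrite (eq_bigr (fun j => u j (al j) (x 0 j))) => [|j ji]; last first.
    by rewrite !mxE (negbTE ji) andbF mulr0 add0r.
  rewrite -/C. ring.
by apply: DeriveDef; [exact: cvgP F | exact: cvg_lim F].
Qed.

Lemma pderiv_tensor al i : pderiv i (tensor al) = tensor (incr al i).
Proof. by apply/funext => x; exact: (derive_val (is_derive := is_derive_tensor al i x)). Qed.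

Lemma tensor_smooth al : smooth (tensor al).
Proof.
move=> s; have [be ->] : exists be, foldr (@pderiv R d) (tensor al) s = tensor be.
  elim: s => [|i s [be ih]]; first by exists al.
  by exists (incr be i); rewrite /= ih pderiv_tensor.
split; first exact: tensor_continuous.
by move=> i x; exact: (ex_derive (is_derive := is_derive_tensor be i x)).
Qed.

End tensor.

(** * Averages of Sobolev functions *)

Section weighted_integrals.
Context (R : realType) (n : nat).
Local Notation E := 'rV[R]_n.+1.
Local Notation m := (@lebesgue_rV R n.+1).

Lemma continuous_measurable_rV (D : set E) (phi : E -> R) :
  measurable D -> continuous phi -> measurable_fun D phi.
Proof.
move=> mD cphi; apply: (measurability _ (RGenOpens.measurableE R)) => // _ [_ [x [y ->]] <-].
apply: measurableI => //; apply: open_measurable_rV; apply: open_comp; last exact: interval_open.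
by move=> z _; exact: cphi.
Qed.

Lemma measurable_box (A : 'I_n.+1 -> set R) : (forall i, closed (A i)) ->
  measurable [set x : E | forall i, A i (x 0 i)].
Proof.
move=> cA; apply: closed_measurable_rV.
rewrite (_ : mkset _ = \bigcap_i ((fun x : E => x 0 i) @^-1` A i)).
  apply: closed_bigI => i _; apply: closed_comp => // x _.
  exact: (@coord_continuous R 1 n.+1 0 i x).
by apply/seteqP; split => [x Ax i _|x Ax i]; [exact: Ax | exact: (Ax i I)].
Qed.

Lemma ball_rVP (p x : E) (r : R) : ball p r x <-> `|p - x| < r.
Proof. by rewrite -ball_normE. Qed.

Lemma lebesgue_ball (p : E) (r : R) : 0 < r -> m (ball p r) = ((2 * r) ^+ n.+1)%:E.
Proof.
move=> r0; rewrite (_ : ball p r = [set x | forall i, ball (p 0 i) r (x 0 i)]); last first.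
  apply/seteqP; split => x.
    by move=> /ball_rVP/(norm_rV_lt _ r0) px i; have := px i; rewrite !mxE.
  move=> px; apply/ball_rVP/(norm_rV_lt _ r0) => i; have := px i.
  by rewrite !mxE.
rewrite (@lebesgue_rV_prod R n.+1 (fun i => ball (p 0 i) r)) => [|i]; last by rewrite ball_itv; exact: measurable_itv.
under eq_bigr do rewrite lebesgue_measure_ball ?ltW// -mulr_natl.
by rewrite prodEFin prodr_const card_ord.
Qed.

Context (D : set E) (mD : measurable D).

Lemma L2_sqr_integrable f : L2 D f -> m.-integrable D (EFin \o (fun x => f x ^+ 2)).
Proof.
move=> [mf foo]; apply/integrableP; split.
  by apply/measurable_EFinP; apply: measurable_funM.
by under eq_integral => x _ do rewrite /= ger0_norm ?sqr_ge0//.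
Qed.

Lemma indic_integrable (Q : set E) : measurable Q -> (m Q < +oo)%E ->
  m.-integrable D (EFin \o (\1_Q : E -> R)).
Proof.
move=> mQ Qoo; apply/integrableP; split.
  by apply/measurable_EFinP; exact: measurable_indic.
under eq_integral => x _ do rewrite /= ger0_norm ?indicE//.
under eq_integral => x _ do rewrite -indicE//.
rewrite integral_indic//; apply: le_lt_trans Qoo.
by apply: le_measure; rewrite ?inE//; exact: measurableI.
Qed.

Lemma L2_sqr_indic_integrable f (Q : set E) : L2 D f -> measurable Q ->
  m.-integrable D (EFin \o (fun x => f x ^+ 2 * \1_Q x)).
Proof.
move=> Lf mQ; apply: le_integrable (L2_sqr_integrable Lf) => //.
  have [mf _] := Lf; apply/measurable_EFinP; apply: measurable_funM; first exact: measurable_funM.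
  exact: measurable_indic.
move=> x _; rewrite /= lee_fin normrM ler_piMr// indicE.
by case: (_ \in _); rewrite ?normr1 ?normr0.
Qed.

(* AM-GM: [|f| <= tau + f ^ 2 / tau] replaces the Cauchy-Schwarz inequality. *)
Lemma weighted_integral_bound (f phi : E -> R) (Q : set E) (M tau : R) :
  L2 D f -> measurable_fun D phi -> measurable Q -> (m Q < +oo)%E ->
  (forall x, `|phi x| <= M * \1_Q x) -> 0 <= M -> 0 < tau ->
  m.-integrable D (EFin \o (fun x => f x * phi x)) /\
  `|\int[m]_(x in D) (f x * phi x)| <=
    M * (tau * fine (m Q) + tau^-1 * \int[m]_(x in D) (f x ^+ 2 * \1_Q x)).
Proof.
move=> Lf mphi mQ Qoo phiQ M0 tau0; have [mf _] := Lf.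
pose h x := M * (tau * \1_Q x + tau^-1 * (f x ^+ 2 * \1_Q x)).
have i1 := indic_integrable mQ Qoo.
have i2 := L2_sqr_indic_integrable Lf mQ.
have i1' := integrableZl mD tau i1.
have i2' := integrableZl mD tau^-1 i2.
have i3 := integrableD mD i1' i2'.
have i4 := integrableZl mD M i3.
have hint : m.-integrable D (EFin \o h) by [].
have fh x : `|f x * phi x| <= h x.
  rewrite normrM; apply: le_trans (_ : _ <= `|f x| * (M * \1_Q x)) _; first exact: ler_wpM2l.
  rewrite /h mulrCA ler_wpM2l// mulrA -mulrDl ler_wpM2r ?indicE//.
  rewrite -(ler_pM2l tau0) mulrDr [tau * (_ * _)]mulrA mulfV ?gt_eqF// mul1r.
  rewrite -[f x ^+ 2]real_normK ?num_real//.
  have := sqr_ge0 (tau - `|f x|); have := sqr_ge0 (tau + `|f x|); nra.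
have mfphi : measurable_fun D (fun x => f x * phi x) by exact: measurable_funM.
have fint : m.-integrable D (EFin \o (fun x => f x * phi x)).
  apply: le_integrable hint => //; first exact/measurable_EFinP.
  by move=> x _; rewrite /= lee_fin (le_trans (fh x))// ler_norm.
split => //; apply: le_trans (le_normr_Rintegral _ fint) _ => //.
apply: le_trans (le_Rintegral _ _ hint _) _ => //.
  exact: (integrable_norm fint).
rewrite /h RintegralZl// RintegralD// RintegralZl// RintegralZl//.
rewrite (_ : \int[m]_(x in D) \1_Q x = fine (m (Q `&` D))); last first.
  by rewrite /Rintegral integral_indic.
apply: ler_wpM2l => //; apply: lerD => //; apply: ler_wpM2l; first exact: ltW.
have mQD : measurable (Q `&` D) by exact: measurableI.
have QDQ : (m (Q `&` D) <= m Q)%E by apply: le_measure; rewrite ?inE.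
by apply: fine_le => //; rewrite ge0_fin_numE//; exact: le_lt_trans QDQ Qoo.
Qed.

End weighted_integrals.

(** * Kernels, and the fluxes connecting two of them *)

Section kernel.
Context (R : realType) (n : nat) (u : nat -> R -> R) (M c : R).
Local Notation E := 'rV[R]_n.+1.
Local Notation m := (@lebesgue_rV R n.+1).
Hypothesis du : derivative_tower u.
Hypothesis u_left : forall x, x <= 0 -> u 0%N x = 0.
Hypothesis u_right : forall x, 1 <= x -> u 0%N x = 1.
Hypothesis u_01 : forall x, 0 <= u 0%N x <= 1.
Hypothesis u1_bound : forall x, 0 <= u 1%N x <= M.
Hypothesis u1_supp : forall x, (x <= 0) || (1 <= x) -> u 1%N x = 0.
Hypothesis c_gt0 : 0 < c.
Hypothesis u1_lower : forall x, 4^-1 <= x <= 3 / 4 -> c <= u 1%N x.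

Let rescale_arg (a r x : R) : r^-1 * x + (- a / r) = (x - a) / r.
Proof. by rewrite mulrBl mulNr mulrC. Qed.

Let M_ge0 : 0 <= M.
Proof. by have /andP[h1 h2] := u1_bound 0; exact: le_trans h2. Qed.

Lemma rescale1_bound a r x : 0 < r -> 0 <= rescale u a r 1 x <= M / r.
Proof.
move=> r0; rewrite /rescale expr1 [M / r]mulrC; have ri : 0 < r^-1 by rewrite invr_gt0.
by have /andP[h1 h2] := u1_bound (r^-1 * x + - a / r); rewrite mulr_ge0 ?(ltW ri)//= ler_pM2l.
Qed.

Lemma rescale1_supp a r x : 0 < r -> (x <= a) || (a + r <= x) -> rescale u a r 1 x = 0.
Proof.
move=> r0 xa; rewrite /rescale rescale_arg u1_supp ?mulr0//.
rewrite ler_pdivrMr// ler_pdivlMr// mul0r mul1r subr_le0 lerBrDr addrC.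
exact: xa.
Qed.

Lemma rescale1_lower a r x : 0 < r -> a + r / 4 <= x <= a + 3 / 4 * r ->
  c / r <= rescale u a r 1 x.
Proof.
move=> r0 /andP[x1 x2]; rewrite /rescale rescale_arg expr1 [c / r]mulrC ler_pM2l ?invr_gt0//.
by apply: u1_lower; rewrite ler_pdivlMr// ler_pdivrMr//; apply/andP; split; lra.
Qed.

Lemma rescale0_left a r x : 0 < r -> x <= a -> rescale u a r 0 x = 0.
Proof.
move=> r0 xa; rewrite /rescale rescale_arg u_left ?mulr0//.
by rewrite pmulr_lle0 ?invr_gt0// subr_le0.
Qed.

Lemma rescale0_right a r x : 0 < r -> a + r <= x -> rescale u a r 0 x = 1.
Proof.
move=> r0 xa; rewrite /rescale rescale_arg u_right ?mulr1//.
by rewrite ler_pdivlMr// mul1r; lra.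
Qed.

Lemma rescale0_01 a r x : 0 <= rescale u a r 0 x <= 1.
Proof. by rewrite /rescale expr0 mul1r. Qed.

Definition kernel (p : E) (r : R) : E -> R :=
  tensor (fun j => rescale u (p 0 j) r) (fun=> 1%N).

Section interpolation.
Variables (p p' : E) (r r' : R).
Hypothesis r'0 : 0 < r'.
Hypothesis r'r : r' <= r.
Hypothesis rr' : r <= 2 * r'.
Hypothesis pp' : `|p' - p| <= r.

Let r0 : 0 < r. Proof. exact: lt_le_trans r'r. Qed.

Let pp'j j : `|p' 0 j - p 0 j| <= r.
Proof. by have /(norm_rV_le _ (ltW r0)) := pp'; move=> /(_ j); rewrite !mxE. Qed.

(** Stage [i] of the passage from [(p, r)] to [(p', r')]: the first [i] coordinates have been
    switched. *)
Definition mixed (i : nat) (j : 'I_n.+1) : nat -> R -> R :=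
  if (j < i)%N then rescale u (p' 0 j) r' else rescale u (p 0 j) r.

Definition mixed_kernel i : E -> R := tensor (mixed i) (fun=> 1%N).

(** Coordinate [i] carries the undifferentiated difference of the two steps, the others carry bumps;
    [pderiv i] then yields the difference of two successive stages. *)
Definition flux_tower (i j : 'I_n.+1) : nat -> R -> R :=
  if j == i then (fun k => rescale u (p 0 j) r k \- rescale u (p' 0 j) r' k)
  else (fun k => mixed i j k.+1).

Definition flux i : E -> R := tensor (flux_tower i) (fun=> 0%N).

Lemma mixed_kernel0 : mixed_kernel 0 = kernel p r.
Proof. by []. Qed.

Lemma mixed_kernel_last : mixed_kernel n.+1 = kernel p' r'.
Proof. by apply/funext => x; apply: eq_bigr => j _; rewrite /mixed ltn_ord. Qed.

Lemma mixed_tower i j : derivative_tower (mixed i j).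
Proof. by rewrite /mixed; case: ifP => _; exact: derivative_tower_rescale. Qed.

Lemma flux_tower_derivative i j : derivative_tower (flux_tower i j).
Proof.
rewrite /flux_tower; case: ifP => _.
  by apply: derivative_towerB; exact: derivative_tower_rescale.
exact: (derivative_towerS (mixed_tower i j)).
Qed.

Lemma pderiv_flux i x : pderiv i (flux i) x = mixed_kernel i x - mixed_kernel i.+1 x.
Proof.
rewrite (pderiv_tensor (flux_tower_derivative i)) /mixed_kernel /tensor (bigD1 i)//=.
rewrite [X in _ = X - _](bigD1 i)//= [X in _ = _ - X](bigD1 i)//=.
rewrite /flux_tower /incr !eqxx /mixed ltnn ltnSn.
rewrite -[X in X * _ = _]/(rescale u (p 0 i) r 1 (x 0 i) - rescale u (p' 0 i) r' 1 (x 0 i)).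
rewrite mulrBl; congr (_ * _ - _ * _); apply: eq_bigr => j ji; rewrite (negbTE ji)//.
have jin : (j == i :> nat) = false by exact: negbTE ji.
by rewrite [in RHS]ltnS [in RHS]leq_eqVlt jin.
Qed.

(** A box containing the supports of all stages and fluxes, because [p'] is within [r] of [p] and
    [r' <= r]. *)
Definition hull : set E := [set x | forall j, `[p 0 j - 2 * r, p 0 j + 2 * r]%classic (x 0 j)].

Lemma hull_compact : compact hull.
Proof.
have h (j : 'I_n.+1) : compact `[p 0 j - 2 * r, p 0 j + 2 * r]%classic by exact: segment_compact.
exact: (rV_compact h).
Qed.

Lemma hull_ball : hull `<=` ball p (3 * r).
Proof.
move=> x xh; apply/ball_rVP/norm_rV_lt => [|j]; first by rewrite mulr_gt0.
by have := xh j; rewrite /= in_itv/= !mxE ltr_norml => /andP[h1 h2]; have := r0; lra.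
Qed.

(** The factor 2 comes from [r <= 2 * r']. *)
Lemma mixed_bound i j y : 0 <= mixed i j 1 y <= 2 * M / r.
Proof.
have h : M / r' <= 2 * M / r.
  by rewrite ler_pdivrMr// mulrAC ler_pdivlMr// [2 * M]mulrC -mulrA ler_wpM2l.
have h' : M / r <= 2 * M / r by rewrite ler_pM2r ?invr_gt0// ler_peMl// ler1n.
rewrite /mixed; case: ifP => _.
  by have /andP[-> h2] := rescale1_bound (p' 0 j) y r'0; exact: le_trans h2 h.
by have /andP[-> h2] := rescale1_bound (p 0 j) y r0; exact: le_trans h2 h'.
Qed.

Lemma mixed_supp i j y : ~ `[p 0 j - 2 * r, p 0 j + 2 * r]%classic y -> mixed i j 1 y = 0.
Proof.
rewrite /= in_itv/= => /negP; rewrite negb_and -!ltNge => yr.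
have := pp'j j; rewrite ler_norml => /andP[h1 h2]; have r00 := r0; have r'r0 := r'r.
rewrite /mixed; case: ifP => _; apply: rescale1_supp => //; case/orP: yr => yr; apply/orP.
- by left; lra.
- by right; lra.
- by left; lra.
- by right; lra.
Qed.

Lemma flux_factor_supp i j y : ~ `[p 0 j - 2 * r, p 0 j + 2 * r]%classic y ->
  flux_tower i j 0 y = 0.
Proof.
move=> yr; rewrite /flux_tower; case: ifPn => _; last exact: mixed_supp.
move: yr; rewrite /= in_itv/= => /negP; rewrite negb_and -!ltNge => /orP yr.
have := pp'j j; rewrite ler_norml => /andP[h1 h2]; have r00 := r0; have r'r0 := r'r.
case: yr => yr; first by rewrite !rescale0_left ?subrr//; lra.
by rewrite !rescale0_right ?subrr//; lra.
Qed.

Lemma flux_factor_bound i j y : `|flux_tower i j 0 y| <= if j == i then 1 else 2 * M / r.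
Proof.
rewrite /flux_tower; case: ifPn => _; last by have /andP[h1 h2] := mixed_bound i j y; rewrite ger0_norm.
have /andP[a1 a2] := rescale0_01 (p 0 j) r y; have /andP[b1 b2] := rescale0_01 (p' 0 j) r' y.
by rewrite /= ler_norml; apply/andP; split; lra.
Qed.

Lemma tensor_hull (v : 'I_n.+1 -> nat -> R -> R) al x :
  (forall j y, ~ `[p 0 j - 2 * r, p 0 j + 2 * r]%classic y -> v j (al j) y = 0) ->
  ~ hull x -> tensor v al x = 0.
Proof.
move=> v0 /existsNP[j xj]; rewrite /tensor (bigD1 j)//= v0 ?mul0r//.
Qed.

Lemma mixed_kernel_ge0 i x : 0 <= mixed_kernel i x.
Proof. by apply: prodr_ge0 => j _; have /andP[] := mixed_bound i j (x 0 j). Qed.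

Lemma mixed_kernel_bound i x :
  `|mixed_kernel i x| <= (2 * M / r) ^+ n.+1 * \1_(ball p (3 * r)) x.
Proof.
have M2 : 0 <= 2 * M / r by rewrite divr_ge0 ?mulr_ge0// ltW.
rewrite ger0_norm ?mixed_kernel_ge0// indicE.
have [/hull_ball xh|nxh] := pselect (hull x); last first.
  rewrite /mixed_kernel (tensor_hull _ nxh) ?mulr_ge0 ?exprn_ge0//.
  by move=> j y; exact: mixed_supp.
rewrite mem_set// mulr1 /mixed_kernel /tensor.
have -> : (2 * M / r) ^+ n.+1 = \prod_(j < n.+1) (2 * M / r) by rewrite prodr_const card_ord.
by apply: ler_prod => j _; apply: mixed_bound.
Qed.

(** One factor is bounded by 1 instead of [2 * M / r]: the power of [r] gained over
    [mixed_kernel_bound] is the usual gain of an integration by parts. *)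
Lemma flux_bound i x : `|flux i x| <= (2 * M / r) ^+ n * \1_(ball p (3 * r)) x.
Proof.
have M2 : 0 <= 2 * M / r by rewrite divr_ge0 ?mulr_ge0// ltW.
rewrite indicE; have [/hull_ball xh|nxh] := pselect (hull x); last first.
  rewrite /flux (tensor_hull _ nxh) ?normr0 ?mulr_ge0 ?exprn_ge0//.
  by move=> j y; exact: flux_factor_supp.
rewrite mem_set// mulr1 /flux /tensor normr_prod.
have -> : (2 * M / r) ^+ n = \prod_(j < n.+1) (if j == i then 1 else 2 * M / r).
  rewrite (bigD1 i)//= eqxx mul1r (eq_bigr (fun=> 2 * M / r)) => [|j /negbTE -> //].
  by rewrite prodr_const cardC1 card_ord.
by apply: ler_prod => j _; rewrite normr_ge0 flux_factor_bound.
Qed.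

Lemma flux_test_function (D : set E) i : ball p (3 * r) `<=` D -> test_function D (flux i).
Proof.
move=> pD; split; first by apply: tensor_smooth => j; exact: flux_tower_derivative.
exists hull; split; [exact: hull_compact | exact: subset_trans hull_ball pD|].
by move=> x; apply: tensor_hull => j y; exact: flux_factor_supp.
Qed.

Lemma mixed_kernel_continuous i : continuous (mixed_kernel i).
Proof. by apply: tensor_continuous => j; exact: mixed_tower. Qed.

Lemma flux_continuous i : continuous (flux i).
Proof. by apply: tensor_continuous => j; exact: flux_tower_derivative. Qed.

Context (D : set E) (D_open : open D) (pD : ball p (3 * r) `<=` D).
Context (f : E -> R) (g : E -> E) (Lf : L2 D f) (fg : weak_gradient D f g).

Let mD : measurable D. Proof. exact: open_measurable_rV. Qed.

Let mQ : measurable (ball p (3 * r)).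
Proof. by apply: open_measurable_rV; exact: ball_open. Qed.

Let r3 : 0 < 3 * r. Proof. by rewrite mulr_gt0. Qed.

Let Qfin : (m (ball p (3 * r)) < +oo)%E.
Proof. by rewrite lebesgue_ball// ltry. Qed.

Let M2r : 0 <= 2 * M / r. Proof. by rewrite divr_ge0 ?mulr_ge0// ltW. Qed.

Lemma average_bound i (tau : R) : 0 < tau ->
  m.-integrable D (EFin \o (fun x => f x * mixed_kernel i x)) /\
  `|\int[m]_(x in D) (f x * mixed_kernel i x)| <= (2 * M / r) ^+ n.+1 *
    (tau * (6 * r) ^+ n.+1 + tau^-1 * \int[m]_(x in D) (f x ^+ 2 * \1_(ball p (3 * r)) x)).
Proof.
move=> tau0; have := weighted_integral_bound mD Lf
  (continuous_measurable_rV mD (@mixed_kernel_continuous i)) mQ Qfin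
  (mixed_kernel_bound i) (exprn_ge0 _ M2r) tau0.
by rewrite lebesgue_ball//= mulrA -natrM.
Qed.

Definition energy (g : E -> E) (Q : set E) : R :=
  \sum_i \int[m]_(x in D) (g x 0 i ^+ 2 * \1_Q x).

(** The difference telescopes over the stages, and [flux i] moves each term to the weak gradient.
    The weight [tau] stays free, to be balanced against the energy. *)
Lemma average_step (tau : R) : 0 < tau ->
  `|\int[m]_(x in D) (f x * kernel p r x) - \int[m]_(x in D) (f x * kernel p' r' x)| <=
  (2 * M / r) ^+ n * (n.+1%:R * (tau * (6 * r) ^+ n.+1) + tau^-1 * energy g (ball p (3 * r))).
Proof.
move=> tau0; pose A i := \int[m]_(x in D) (f x * mixed_kernel i x).
rewrite -mixed_kernel_last -mixed_kernel0 -/(A 0%N) -/(A n.+1) distrC.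
rewrite -(telescope_sumr A (leq0n _)) big_mkord.
apply: le_trans (ler_norm_sum _ _ _) _.
set Y := tau * _; have -> : n.+1%:R * Y = \sum_(i < n.+1) Y by rewrite sumr_const card_ord mulr_natl.
rewrite /energy [tau^-1 * _]mulr_sumr -big_split mulr_sumr /=; apply: ler_sum => i _.
have -> : `|A i.+1 - A i| = `|\int[m]_(x in D) (g x 0 i * flux i x)|.
  rewrite distrC -RintegralB//; [|exact: (average_bound _ tau0).1..].
  rewrite -[RHS]normrN; congr (`| _ |).
  rewrite (_ : (fun x => _) = (fun x => f x * pderiv i (flux i) x)); last first.
    by apply/funext => x; rewrite pderiv_flux mulrBr.
  by rewrite /Rintegral fg.2 ?fineN//; exact: flux_test_function.
have [_] := weighted_integral_bound mD (fg.1 i)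
  (continuous_measurable_rV mD (@flux_continuous i)) mQ Qfin
  (flux_bound i) (exprn_ge0 _ M2r) tau0.
by rewrite /Y lebesgue_ball//= mulrA -natrM.
Qed.

End interpolation.

Lemma kernel_ge0 p r x : 0 < r -> 0 <= kernel p r x.
Proof. by move=> r0; apply: prodr_ge0 => j _; have /andP[] := rescale1_bound (p 0 j) (x 0 j) r0. Qed.

(** Bounds for a single kernel are those of stage 0 of the passage from [(p, r)] to itself. *)
Lemma kernel_bound p r x : 0 < r -> `|kernel p r x| <= (2 * M / r) ^+ n.+1 * \1_(ball p (3 * r)) x.
Proof.
move=> r0; have r2 : r <= 2 * r by rewrite ler_peMl ?ler1n// ltW.
have pp : `|p - p| <= r by rewrite subrr normr0 ltW.
exact: (mixed_kernel_bound r0 (lexx r) r2 pp 0).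
Qed.

Lemma kernel_average_bound D f p r tau : open D -> L2 D f -> 0 < r -> 0 < tau ->
  m.-integrable D (EFin \o (fun x => f x * kernel p r x)) /\
  `|\int[m]_(x in D) (f x * kernel p r x)| <= (2 * M / r) ^+ n.+1 *
    (tau * (6 * r) ^+ n.+1 + tau^-1 * \int[m]_(x in D) (f x ^+ 2 * \1_(ball p (3 * r)) x)).
Proof.
move=> oD Lf r0 tau0; have r2 : r <= 2 * r by rewrite ler_peMl ?ler1n// ltW.
have pp : `|p - p| <= r by rewrite subrr normr0 ltW.
exact: (average_bound r0 (lexx r) r2 pp oD Lf 0 tau0).
Qed.

(** On the middle cube [S], of volume [(r / 2) ^+ n.+1], the kernel is at least [(c / r) ^+ n.+1];
    the scale cancels in the product. *)
Lemma kernel_average_ge D f O p r : open D -> L2 D f -> 0 < r ->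
  {ae m, forall x, (O `&` D) x -> 1 <= f x} ->
  ball p (3 * r) `<=` O -> ball p (3 * r) `<=` D ->
  (c / 2) ^+ n.+1 <= \int[m]_(x in D) (f x * kernel p r x).
Proof.
move=> oD Lf r0 f1 pO pD.
have mD : measurable D by exact: open_measurable_rV.
have [mf _] := Lf.
pose S : set E := [set x | forall j, `[p 0 j + r / 4, p 0 j + 3 / 4 * r]%classic (x 0 j)].
have mS : measurable S.
  apply: (@measurable_box R n (fun j => `[p 0 j + r / 4, p 0 j + 3 / 4 * r]%classic)).
  by move=> j; exact: itv_closed.
have SE : m S = ((r / 2) ^+ n.+1)%:E.
  rewrite (@lebesgue_rV_prod R n.+1 (fun j => `[p 0 j + r / 4, p 0 j + 3 / 4 * r]%classic))//.
  rewrite (eq_bigr (fun=> (r / 2)%:E)) => [|j _].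
    by rewrite prodEFin prodr_const card_ord.
  rewrite lebesgue_measure_itv/= lte_fin ifT; last lra.
  by rewrite -EFinD; congr (_%:E); field.
have SD : S `<=` D.
  apply: subset_trans pD => x Sx; apply/ball_rVP/norm_rV_lt => [|j]; first by rewrite mulr_gt0.
  have := Sx j; rewrite /= in_itv/= !mxE ltr_norml => /andP[h1 h2]; lra.
have kc : continuous (kernel p r).
  by apply: tensor_continuous => j; exact: derivative_tower_rescale.
have mk : measurable_fun D (kernel p r) by exact: continuous_measurable_rV.
have k0 x : 0 <= kernel p r x by exact: kernel_ge0.
have [fkint _] := kernel_average_bound p oD Lf r0 (@ltr01 R).
have cr0 : 0 <= (c / r) ^+ n.+1 by rewrite exprn_ge0// divr_ge0// ltW.
have mfk : measurable_fun D (fun x => `|f x| * kernel p r x).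
  by apply: measurable_funM => //; exact: measurableT_comp.
(* The kernel vanishes off the ball, and [f >= 1] almost everywhere on it; passing to the absolute
   value makes the integrand nonnegative everywhere. *)
have ae_eq_abs : ae_eq m D (fun x => (f x * kernel p r x)%:E) (fun x => (`|f x| * kernel p r x)%:E).
  apply: filterS f1 => x f1x Dx; congr (_%:E).
  have [xb|nxb] := pselect (ball p (3 * r) x).
    by rewrite ger0_norm// (le_trans _ (f1x _))//; split => //; exact: pO.
  have := kernel_bound p x r0; rewrite indicE memNset// mulr0 normr_le0 => /eqP ->.
  by rewrite !mulr0.
have -> : \int[m]_(x in D) (f x * kernel p r x) = \int[m]_(x in D) (`|f x| * kernel p r x).
  rewrite /Rintegral; congr fine; apply: ae_eq_integral => //.
    by apply/measurable_EFinP; exact: measurable_funM.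
  exact/measurable_EFinP.
have afin : (\int[m]_(x in D) (`|f x| * kernel p r x)%:E < +oo)%E.
  have /integrableP[_] := fkint; apply: le_lt_trans; rewrite le_eqVlt; apply/orP; left.
  apply/eqP/eq_integral => x _; rewrite /= normrM [in RHS](ger0_norm (k0 x))//.
rewrite -lee_fin /Rintegral fineK; last first.
  rewrite ge0_fin_numE//; apply: integral_ge0 => x _.
  by rewrite lee_fin mulr_ge0.
have -> : (((c / 2) ^+ n.+1)%:E = \int[m]_(x in D) ((c / r) ^+ n.+1 * \1_S x)%:E)%E.
  under eq_integral => x _ do rewrite EFinM.
  have S0 x : D x -> (0 <= (\1_S x : R)%:E)%E by rewrite lee_fin indicE.
  have mSi : measurable_fun D (fun x => (\1_S x : R)%:E).
    by apply/measurable_EFinP; exact: measurable_indic.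
  rewrite ge0_integralZl_EFin//.
  rewrite integral_indic// (setIidl SD) [X in (_ * X)%E](_ : _ = ((r / 2) ^+ n.+1)%:E)//.
  rewrite -EFinM -exprMn; congr ((_ ^+ _)%:E).
  by field; rewrite gt_eqF.
apply: ae_ge0_le_integral => //.
- by move=> x _; rewrite lee_fin mulr_ge0// indicE.
- by apply/measurable_EFinP; apply: measurable_funM => //; exact: measurable_indic.
- by move=> x _; rewrite lee_fin mulr_ge0.
- exact/measurable_EFinP.
apply: filterS f1 => x f1x Dx; rewrite lee_fin indicE.
have [xS|nxS] := pselect (S x); last by rewrite memNset// mulr0 mulr_ge0.
rewrite mem_set// mulr1; apply: le_trans (_ : _ <= 1 * kernel p r x) _; last first.
  rewrite ler_wpM2r// (le_trans _ (ler_norm _))// f1x//; split => //; apply: pO.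
  apply/ball_rVP/norm_rV_lt => [|j]; first by rewrite mulr_gt0.
  have := xS j; rewrite /= in_itv/= !mxE ltr_norml => /andP[h1 h2]; lra.
rewrite mul1r /kernel /tensor.
have -> : (c / r) ^+ n.+1 = \prod_(j < n.+1) (c / r) by rewrite prodr_const card_ord.
apply: ler_prod => j _; rewrite divr_ge0 ?(ltW c_gt0) ?(ltW r0)//=.
by apply: rescale1_lower => //; have := xS j; rewrite /= in_itv.
Qed.

End kernel.

(** * Covering by balls of large energy *)

(* If every [Q_k = ball (p k) (3 r_k)] carried less energy than [al ^ 2 r_k ^ n],
   the averages of [f] along the sequence would change by at most a geometric
   series; they start small and end above a constant. *)
Lemma energy_lower_bound (R : realType) (n : nat) (s lam : R) :
  0 < s -> 0 < lam < 1 -> 1 <= 2 * lam ^+ 2 ->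
  let r k := (s * lam ^+ k) ^+ 2 in
  exists al eps : R, [/\ 0 < al, 0 < eps &
  forall (D O : set 'rV[R]_n.+1) f g (p : nat -> 'rV[R]_n.+1),
    open D -> L2 D f -> weak_gradient D f g ->
    {ae @lebesgue_rV R n.+1, forall x, (O `&` D) x -> 1 <= f x} ->
    (forall k, ball (p k) (3 * r k) `<=` D) ->
    (forall k, `|p k.+1 - p k| <= r k) ->
    (exists k, ball (p k) (3 * r k) `<=` O) ->
    \int[@lebesgue_rV R n.+1]_(x in D) (f x ^+ 2) <= eps ->
    exists k, al ^+ 2 * r k ^+ n <= energy D g (ball (p k) (3 * r k))].
Proof.
move=> s0 /andP[l0 l1] l2 r.
have [u [M [c [du [ul ur u01] u1M u1s [c0 u1c]]]]] := smooth_step R.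
have M0 : 0 < M.
  have h : (4^-1 : R) <= (2^-1 : R) <= (3 / 4 : R) by lra.
  by have /andP[_] := u1M 2^-1; apply: lt_le_trans; apply: lt_le_trans (u1c _ h).
have sk0 k : 0 < s * lam ^+ k by rewrite mulr_gt0// exprn_gt0.
have r0 k : 0 < r k by rewrite exprn_gt0.
pose ka := (c / 2) ^+ n.+1.
have ka0 : 0 < ka by rewrite exprn_gt0// divr_gt0.
pose P := (2 * M) ^+ n * (n.+1%:R * 6 ^+ n.+1 + 1).
have P0 : 0 < P.
  by rewrite mulr_gt0 ?exprn_gt0 ?mulr_gt0// ltr_wpDl// mulr_ge0 ?exprn_ge0.
(* Chosen so that the geometric series has sum [P * al * s / (1 - lam) = ka / 3]. *)
pose al := ka * (1 - lam) / (3 * s * P).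
have l10 : 0 < 1 - lam by rewrite subr_gt0.
have al0 : 0 < al.
  apply: divr_gt0; first exact: mulr_gt0.
  by apply: mulr_gt0 => //; exact: mulr_gt0.
(* [tau], and then [eps], make each of the two terms bounding the average at [k = 0] equal to
   [ka / 6]. *)
pose tau := ka / (6 * (12 * M) ^+ n.+1).
have M12 : 0 < (12 * M) ^+ n.+1 by rewrite exprn_gt0// mulr_gt0.
have tau0 : 0 < tau by rewrite divr_gt0// mulr_gt0.
have M20 : 0 < (2 * M / r 0%N) ^+ n.+1 by rewrite exprn_gt0// divr_gt0// mulr_gt0.
pose eps := tau * ka / (6 * (2 * M / r 0%N) ^+ n.+1).
have eps0 : 0 < eps by apply: divr_gt0; [exact: mulr_gt0 | apply: mulr_gt0].
exists al, eps; split => // D O f g p oD Lf fg f1 pD pp [N pO] feps.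
apply: contrapT => /forallNP small.
have {}small k : energy D g (ball (p k) (3 * r k)) <= al ^+ 2 * r k ^+ n.
  by apply/ltW; rewrite ltNge; apply/negP; exact: small.
pose A k := \int[@lebesgue_rV R n.+1]_(x in D) (f x * kernel u (p k) (r k) x).
have step k : `|A k - A k.+1| <= P * al * (s * lam ^+ k).
  have rS : r k.+1 = lam ^+ 2 * r k by rewrite /r [lam ^+ k.+1]exprS; ring.
  have rr : r k.+1 <= r k by rewrite rS ler_piMl ?(ltW (r0 k))// expr_le1// ltW.
  have rr2 : r k <= 2 * r k.+1 by rewrite rS mulrA ler_peMl// ltW.
  (* This weight balances the two terms of [average_step]: both become multiples of
     [al * (s * lam ^+ k)]. *)
  have tk0 : 0 < al / (s * lam ^+ k) by rewrite divr_gt0.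
  apply: le_trans (average_step du ul ur u01 u1M u1s (r0 k.+1) rr rr2 (pp k) oD (pD k) Lf fg tk0) _.
  have e1 : (al / (s * lam ^+ k))^-1 * energy D g (ball (p k) (3 * r k)) <=
      (al / (s * lam ^+ k))^-1 * (al ^+ 2 * r k ^+ n).
    by rewrite ler_wpM2l ?invr_ge0 ?(ltW tk0).
  have c2 : 0 <= (2 * M / r k) ^+ n by rewrite exprn_ge0// divr_ge0 ?(ltW (r0 k))// mulr_ge0 ?(ltW M0).
  apply: le_trans (ler_wpM2l c2 (lerD (lexx _) e1)) _.
  rewrite le_eqVlt; apply/orP; left; apply/eqP.
  rewrite /P; set t := s * lam ^+ k in tk0 *.
  have t0 : t != 0 by rewrite gt_eqF//; exact: sk0.
  have al0' : al != 0 by rewrite gt_eqF.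
  have [T [rT Tt T0]] : exists T, [/\ r k = T, T = t * t & T != 0].
    by exists (r k); rewrite gt_eqF// {2}/r expr2.
  rewrite rT expr_div_n ![(6 * T) ^+ _]exprMn [T ^+ n.+1]exprS.
  have W0 : T ^+ n != 0 by rewrite expf_neq0.
  move: (T ^+ n) W0 => W W0; rewrite Tt; field.
  by rewrite t0 al0' W0.
have sum k : `|A 0%N - A k| <= P * al * s * ((1 - lam ^+ k) / (1 - lam)).
  have l10' : 1 - lam != 0 by rewrite gt_eqF.
  elim: k => [|k ih]; first by rewrite subrr normr0 expr0 subrr mul0r mulr0.
  apply: le_trans (ler_distD (A k) _ _) _; apply: le_trans (lerD ih (step k)) _.
  rewrite le_eqVlt; apply/orP; left; apply/eqP; rewrite exprS; field.
  exact: l10'.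
have bound k : `|A 0%N - A k| <= ka / 3.
  apply: le_trans (sum k) _; apply: le_trans (_ : _ <= P * al * s * (1 / (1 - lam))) _.
    apply: ler_wpM2l; first by apply: mulr_ge0; [apply: mulr_ge0|]; exact: ltW.
    by rewrite ler_wpM2r ?invr_ge0 ?subr_ge0 ?(ltW l1)// lerBlDr lerDl exprn_ge0// ltW.
  rewrite le_eqVlt; apply/orP; left; apply/eqP; rewrite /al; field.
  by rewrite !gt_eqF.
have A0 : `|A 0%N| <= ka / 3.
  have [_] := kernel_average_bound du u1M u1s (p 0%N) oD Lf (r0 0%N) tau0.
  move=> /le_trans; apply.
  have mD : measurable D by exact: open_measurable_rV.
  have mQ : measurable (ball (p 0%N) (3 * r 0%N)).
    by apply: open_measurable_rV; exact: ball_open.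
  have fQ : \int[@lebesgue_rV R n.+1]_(x in D) (f x ^+ 2 * \1_(ball (p 0%N) (3 * r 0%N)) x) <= eps.
    apply: le_trans feps; apply: le_Rintegral => //.
    - exact: L2_sqr_indic_integrable.
    - exact: L2_sqr_integrable.
    move=> x _; apply: ler_piMr; first exact: sqr_ge0.
    by rewrite indicE; case: (x \in _).
  have tau1 : 0 <= tau^-1 by rewrite invr_ge0 ltW.
  apply: le_trans (ler_wpM2l (ltW M20) (lerD (lexx _) (ler_wpM2l tau1 fQ))) _.
  rewrite mulrDr [X in X + _](_ : _ = tau * (12 * M) ^+ n.+1); last first.
    rewrite mulrCA -exprMn; congr (_ * _ ^+ _).
    by field; rewrite gt_eqF.
  rewrite (_ : tau * _ = ka / 6); last by rewrite /tau; field; rewrite gt_eqF.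
  rewrite [X in _ + X](_ : _ = ka / 6); last by rewrite /eps; field; rewrite !gt_eqF.
  lra.
have AN : ka <= A N by exact: (kernel_average_ge du u1M u1s c0 u1c oD Lf (r0 N) f1 pO (pD N)).
have := bound N; move: A0; rewrite !ler_norml => /andP[_ h1] /andP[h2 _]; lra.
Qed.

Lemma rat_dense_rV (R : realType) (n : nat) (U : set 'rV[R]_n.+1) : open U -> U !=set0 ->
  exists q : 'rV[rat]_n.+1, U (map_mx ratr q).
Proof.
move=> oU [x Ux].
have /nbhs_ballP[e /= e0 xU] : nbhs x U by exact: open_nbhs_nbhs.
have /choice[q qP] : forall i, exists q : rat, `|x 0 i - ratr q| < e.
  move=> i; have xe : x 0 i - e < x 0 i + e by lra.
  have [q] := rat_in_itvoo xe; rewrite in_itv/= => /andP[q1 q2].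
  by exists q; rewrite ltr_norml; apply/andP; split; lra.
exists (\row_i q i); apply: xU; apply/ball_rVP/norm_rV_lt => // i.
by rewrite !mxE.
Qed.

(* By Zorn, take a disjoint subfamily maximal among those with the property that
   whatever meets the subfamily meets a member of no larger level: a set of
   minimal level among those meeting no member could still be added. *)
Lemma vitali_levels (R : realType) (n : nat) (I : Type) (V : set I)
    (B : I -> set 'rV[R]_n.+1) (lev : I -> nat) :
  (forall i, V i -> open (B i)) -> (forall i, V i -> B i !=set0) ->
  exists s : nat -> option I,
  [/\ forall k i, s k = Some i -> V i,
      trivIset setT (fun k => if s k is Some i then B i else set0) &
      forall i, V i -> exists k j,
        [/\ s k = Some j, B i `&` B j !=set0 & (lev j <= lev i)%N]].
Proof.
move=> oB B0.
pose dom (F : set I) i := exists j, [/\ F j, B i `&` B j !=set0 & (lev j <= lev i)%N].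
pose P (F : set I) := [/\ F `<=` V, trivIset F B &
  forall i, V i -> (exists2 j, F j & B i `&` B j !=set0) -> dom F i].
have [|A [[AV tA Adom] Amax]] := @Zorn_bigcup I P.
  move=> F FP totF; split.
  - by move=> i [X FX Xi]; have [XV _ _] := FP _ FX; exact: XV.
  - move=> i j [X FX Xi] [Y FY Yj] ij.
    have [XY|YX] := totF _ _ FX FY.
      by have [_ tY _] := FP _ FY; apply: tY => //; exact: XY.
    by have [_ tX _] := FP _ FX; apply: tX => //; exact: YX.
  - move=> i Vi [j [X FX Xj] ij]; have [_ _ Xdom] := FP _ FX.
    have [|k [Xk ik kl]] := Xdom i Vi; first by exists j.
    by exists k; split => //; exists X.
have meet i : V i -> dom A i.
  move=> Vi; apply: (Adom) => //; apply: contrapT => ndi.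
  pose bad j := V j /\ ~ (exists2 k, A k & B j `&` B k !=set0).
  have [i0 [bad0 min0]] : exists j, bad j /\ forall k, bad k -> (lev j <= lev k)%N.
    have : bad i by [].
    move: {-1}(lev i) (erefl (lev i)) => l; elim/ltn_ind: l i Vi ndi => l ih j Vj ndj jl badj.
    have [h|/existsNP[k /not_implyP[badk /negP]]] := pselect (forall k, bad k -> (lev j <= lev k)%N).
      by exists j.
    by rewrite -ltnNge jl => kl; apply: (ih (lev k) kl k badk.1 badk.2).
  have nA0 : ~ A i0.
    move=> Ai0; apply: bad0.2; exists i0 => //; rewrite setIid; exact: B0 bad0.1.
  apply: (Amax (A `|` [set i0])).
    by split => [j Aj|/(_ i0)]; [left | move=> h; apply: nA0; apply: h; right].
  split.
  - by move=> j [/AV//|->]; exact: bad0.1.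
  - move=> j k [Aj|->] [Ak|->] jk //; first exact: tA.
      by exfalso; apply: bad0.2; exists j => //; rewrite setIC.
    by exfalso; apply: bad0.2; exists k.
  - move=> j Vj [k [Ak|->] jk].
      have [|l [Al jl ll]] := Adom j Vj; first by exists k.
      by exists l; split => //; left.
    have [[l Al jl]|nj] := pselect (exists2 l, A l & B j `&` B l !=set0).
      have [|l' [Al' jl' ll']] := Adom j Vj; first by exists l.
      by exists l'; split => //; left.
    (* A set meeting [i0] but no member of [A] is itself bad, so its level is not below that of
       [i0]. *)
    by exists i0; split => //; [right | exact: min0].
have /choice[q qP] : forall i, exists q : 'rV[rat]_n.+1, V i -> B i (map_mx ratr q).
  move=> i; have [Vi|nVi] := pselect (V i); last by exists 0.
  by have [q qB] := rat_dense_rV (oB i Vi) (B0 i Vi); exists q.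
have qinj i j : A i -> A j -> pickle (q i) = pickle (q j) -> i = j.
  move=> Ai Aj /(pcan_inj (@pickleK _)) qij; apply: tA => //.
  by exists (map_mx ratr (q i)); split; [exact/qP/AV | rewrite qij; exact/qP/AV].
have /choice[s sP] : forall k, exists o : option I,
    (forall i, A i -> pickle (q i) = k -> o = Some i) /\
    (forall i, o = Some i -> A i /\ pickle (q i) = k).
  move=> k; have [[i Ai qi]|nk] := pselect (exists2 i, A i & pickle (q i) = k).
    exists (Some i); split => [j Aj qj|_ [<-]//].
    by congr Some; apply: qinj => //; rewrite qj.
  by exists None; split => // i Ai qi; exfalso; apply: nk; exists i.
exists s; split.
- by move=> k i /(sP k).2[/AV].
- move=> k l _ _ [x []]; case sk : (s k) => [i|//]; case sl : (s l) => [j|//] Bi Bj.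
  have [Ai qi] := (sP k).2 _ sk; have [Aj qj] := (sP l).2 _ sl.
  by rewrite -qi -qj; congr (pickle (q _)); apply: tA => //; exists x.
- move=> i /meet[j [Aj ij jl]]; exists (pickle (q j)), j; split => //.
  exact: (sP _).1.
Qed.

(** * Additivity of the energy *)

Section energy.
Context (R : realType) (n : nat) (D : set 'rV[R]_n.+1) (mD : measurable D).
Local Notation E := 'rV[R]_n.+1.
Local Notation m := (@lebesgue_rV R n.+1).
Variable g : E -> E.
Hypothesis Lg : forall i, L2 D (fun x => g x 0 i).

Lemma energy_ge0 Q : 0 <= energy D g Q.
Proof.
apply: sumr_ge0 => i _; apply: Rintegral_ge0 => x _.
by rewrite mulr_ge0 ?sqr_ge0// indicE.
Qed.

Lemma energyU (A B : set E) : measurable A -> measurable B -> A `&` B = set0 ->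
  energy D g (A `|` B) = energy D g A + energy D g B.
Proof.
move=> mA mB AB; rewrite /energy -big_split/=; apply: eq_bigr => i _.
rewrite -RintegralD//; [|exact: L2_sqr_indic_integrable..].
congr Rintegral; apply/funext => x; rewrite -mulrDr; congr (_ * _); rewrite !indicE.
have [xA|nxA] := pselect (A x); have [xB|nxB] := pselect (B x).
- by have : (A `&` B) x by []; rewrite AB.
- by rewrite (mem_set xA) (memNset nxB) (mem_set (_ : (A `|` B) x)) ?addr0//; left.
- by rewrite (memNset nxA) (mem_set xB) (mem_set (_ : (A `|` B) x)) ?add0r//; right.
- by rewrite (memNset nxA) (memNset nxB) (memNset (_ : ~ (A `|` B) x)) ?addr0// => -[].
Qed.

Lemma energy_trivIset (G : (set E)^nat) N : (forall k, measurable (G k)) -> trivIset setT G ->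
  \sum_(k < N) energy D g (G k) <= energy D g (\big[setU/set0]_(k < N) G k).
Proof.
move=> mG tG; elim: N => [|N ih]; first by rewrite !big_ord0 energy_ge0.
rewrite !big_ord_recr/= energyU//.
- by rewrite lerD2r.
- exact: bigsetU_measurable.
apply/seteqP; split => // x [+ GN]; rewrite -bigcup_mkord => -[k /= kN Gk].
have kE : k = N by apply: tG => //; exists x.
by move: kN; rewrite kE ltnn.
Qed.

Lemma energy_le Q : measurable Q -> ((energy D g Q)%:E <= \int[m]_(x in D) (enorm (g x) ^+ 2)%:E)%E.
Proof.
move=> mQ; rewrite /energy -sumEFin.
have -> : (\int[m]_(x in D) (enorm (g x) ^+ 2)%:E =
    \sum_i \int[m]_(x in D) (g x 0 i ^+ 2)%:E)%E.
  rewrite -ge0_integral_sum//; first last.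
  - by move=> i x _; rewrite lee_fin sqr_ge0.
  - by move=> i; have /integrableP[] := L2_sqr_integrable (Lg i).
  apply: eq_integral => x _; rewrite sumEFin /enorm sqr_sqrtr//.
  by apply: sumr_ge0 => i _; exact: sqr_ge0.
apply: lee_sum => i _.
have int1 := L2_sqr_integrable (Lg i).
have int2 := L2_sqr_indic_integrable mD (Lg i) mQ.
rewrite /Rintegral fineK; last exact: (integrable_fin_num mD int2).
have /integrableP[m1 _] := int1; have /integrableP[m2 _] := int2.
apply: ge0_le_integral => //.
- by move=> x _; rewrite lee_fin mulr_ge0 ?sqr_ge0// indicE.
- move=> x _; rewrite lee_fin; apply: ler_piMr; first exact: sqr_ge0.
  by rewrite indicE; case: (x \in _).
Qed.

End energy.

(** * Sets of capacity zero *)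

Section capacity_null.
Context (R : realType) (n : nat).
Local Notation E := 'rV[R]_n.+1.
Local Notation m := (@lebesgue_rV R n.+1).

Lemma geometric_small (s lam e : R) : 0 < s -> 0 < lam < 1 -> 0 < e ->
  exists k, (s * lam ^+ k) ^+ 2 < e.
Proof.
move=> s0 /andP[l0 l1] e0.
have lam1 : `|lam ^+ 2| < 1 by rewrite ger0_norm ?sqr_ge0// exprn_ilt1// ltW.
have es : 0 < e / s ^+ 2 by rewrite divr_gt0 ?exprn_gt0.
have /cvgrPdist_lt/(_ _ es)[k _ /(_ k (leqnn k))] := cvg_expr lam1.
have lk0 : 0 <= (lam ^+ 2) ^+ k by rewrite exprn_ge0// sqr_ge0.
rewrite /= sub0r normrN ger0_norm// ltr_pdivlMr ?exprn_gt0// => h.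
by exists k; rewrite exprMn -exprM mulnC exprM mulrC.
Qed.

Lemma Cap0_test (D A : set E) (e : R) : Cap D A = 0%E -> 0 < e ->
  exists f O, [/\ H1 D f, open O, A `<=` O,
    {ae m, forall x, (O `&` D) x -> 1 <= f x} & (H1norm2 D f < e%:E)%E].
Proof.
move=> capA e0; have : (Cap D A < e%:E)%E by rewrite capA lte_fin.
by move=> /ereal_inf_lt[_ [f [Hf [U [oU AU f1]]] <-] fe]; exists f, U.
Qed.

(** The estimate is local because the constants of [corkscrew] belong to one chart. *)
Lemma Cap0_locally_null (D A : set E) (b : E) : open D -> bilipschitz_boundary D ->
  A `<=` bd D -> Cap D A = 0%E -> bd D b ->
  exists2 rho : R, 0 < rho & hausdorff n (A `&` ball b rho) = 0%E.
Proof.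
move=> oD A1 AD capA bb.
have mD : measurable D by exact: open_measurable_rV.
have [lam [C [sbar [rho [[lam01 lam2 C0 sbar0 rho0] scr]]]]] := corkscrew oD A1 bb.
exists rho => //; apply/eqP; rewrite eq_le outer_measure_ge0 andbT.
apply: hausdorff_le => delta delta0.
apply/lee_addgt0Pr => e e0; rewrite add0e.
(* [c2 * r] bounds the Euclidean diameter of a sup-norm ball of radius [(C + 6) * r]. *)
pose c2 := n.+1%:R * (2 * (C + 6)).
have C6 : 0 < C + 6 by rewrite addr_gt0.
have c20 : 0 < c2 by rewrite !mulr_gt0.
(* The three bounds serve [corkscrew], the inequality [r k <= s], and the admissibility of the
   enlarged balls at scale [delta]. *)
pose s := Num.min sbar (Num.min 1 (delta / c2)).
have s0 : 0 < s by rewrite !lt_min sbar0 ltr01 divr_gt0.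
have ss : s <= sbar by rewrite ge_min lexx.
have s1 : s <= 1 by rewrite !ge_min lexx !orbT.
have sd : s * c2 <= delta by rewrite -ler_pdivlMr// !ge_min lexx !orbT.
have [al [eps [al0 eps0 hit]]] := energy_lower_bound n s0 lam01 lam2.
pose r k := (s * lam ^+ k) ^+ 2.
have /andP[l0 l1] := lam01.
have r0 k : 0 < r k by rewrite exprn_gt0// mulr_gt0// exprn_gt0.
have rs k : r k <= s.
  rewrite /r expr2; have h1 : 0 <= s * lam ^+ k by rewrite mulr_ge0 ?exprn_ge0 ?ltW.
  have h2 : s * lam ^+ k <= s by rewrite ler_piMr ?(ltW s0)// exprn_ile1// ltW.
  apply: le_trans (_ : _ <= s * 1) _; last by rewrite mulr1.
  by apply: ler_pM => //; exact: le_trans s1.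
have r_le k l : (k <= l)%N -> r l <= r k.
  move=> kl; rewrite /r lerXn2r ?nnegrE ?mulr_ge0 ?exprn_ge0 ?(ltW s0) ?(ltW l0)//.
  by rewrite ler_pM2l// ler_wiXn2l ?(ltW l0) ?(ltW l1).
(* [eps] makes [f] small enough for [hit]; the other bound makes the total of the gauges at most
   [e]. *)
pose eta := Num.min eps (e * al ^+ 2 / c2 ^+ n).
have eta0 : 0 < eta by rewrite lt_min eps0 divr_gt0 ?exprn_gt0// mulr_gt0// exprn_gt0.
have [f [U [[Lf exg] oU AU f1 fe]]] := Cap0_test capA eta0.
pose g := grad D f.
have fg : weak_gradient D f g by exact: (xgetPex (fun=> 0) exg).
have gfin : (\int[m]_(x in D) (enorm (g x) ^+ 2)%:E <= eta%:E)%E.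
  apply: le_trans (ltW fe); rewrite /H1norm2 leeDl//.
  by apply: integral_ge0 => x _; rewrite lee_fin sqr_ge0.
have feps : \int[m]_(x in D) (f x ^+ 2) <= eps.
  rewrite -lee_fin /Rintegral fineK; last first.
    exact: (integrable_fin_num mD (L2_sqr_integrable Lf)).
  apply: le_trans (_ : _ <= eta%:E)%E _; last by rewrite lee_fin ge_min lexx.
  apply: le_trans (ltW fe); rewrite /H1norm2 leeDr//.
  by apply: integral_ge0 => x _; rewrite lee_fin sqr_ge0.
pose V : set E := A `&` ball b rho.
have /choice[pk pkP] : forall a, exists pk : E * nat, V a ->
    [/\ ball pk.1 (3 * r pk.2) `<=` D, `|pk.1 - a| <= C * r pk.2 &
        al ^+ 2 * r pk.2 ^+ n <= energy D g (ball pk.1 (3 * r pk.2))].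
  move=> a; have [[Aa /ball_rVP ab]|nV] := pselect (V a); last by exists (0, 0%N).
  rewrite distrC in ab.
  have s0s : 0 < s <= sbar by rewrite s0.
  have [p pP] := scr s a s0s (AD _ Aa) ab.
  have [|k kP] := hit D U f g p oD Lf fg f1 (fun k => let: And3 h _ _ := pP k in h)
    (fun k => let: And3 _ h _ := pP k in h) _ feps.
    have /nbhs_ballP[t /= t0 tU] : nbhs a U.
      by apply: open_nbhs_nbhs; split => //; exact: AU.
    have [k kt] := geometric_small s0 lam01 (divr_gt0 t0 C6).
    exists k => x /ball_rVP px; apply: tU; apply/ball_rVP.
    have [_ _ pa] := pP k; have := ler_distD (p k) a x; rewrite distrC in pa.
    have h : r k * (C + 6) < t by rewrite -ltr_pdivlMr.
    have := r0 k; rewrite /r in h * => h1 h2; lra.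
  by exists (p k, k) => _; have [h1 _ h2] := pP k; split.
pose B a := ball (pk a).1 (3 * r (pk a).2).
have r3 k : 0 < 3 * r k by rewrite mulr_gt0.
have [a Va|a Va|sel [selV tsel selP]] := @vitali_levels R n E V B (fun a => (pk a).2).
- exact: ball_open.
- by exists (pk a).1; apply: ballxx.
pose G k := if sel k is Some a then B a else set0.
have mG k : measurable (G k).
  by rewrite /G; case: (sel k) => // a; apply: open_measurable_rV; exact: ball_open.
(* If the ball of a point meets a selected ball of no larger level, with parameter [r], the point is
   within [C * r + 3 * r + 3 * r] of the selected centre. *)
pose W k : set E := if sel k is Some a
  then [set x | `|x - (pk a).1| <= (C + 6) * r (pk a).2] else set0.
have Wdiam k a : sel k = Some a -> forall x y, W k x -> W k y ->
    enorm (x - y) <= c2 * r (pk a).2.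
  move=> ka x y; rewrite /W ka /= => xp yp.
  apply: le_trans (enorm_le_norm _) _; rewrite /c2 -!mulrA ler_pM2l//.
  have := ler_distD (pk a).1 x y; rewrite (distrC (pk a).1 y) => h; lra.
have Wcover : V `<=` \bigcup_k W k.
  move=> a Va; have [k [j [kj [z [/ball_rVP az /ball_rVP jz]] jl]]] := selP a Va.
  exists k => //; rewrite /W kj /=.
  have [_ ap _] := pkP a Va.
  have rr := r_le _ _ jl; have CC : C * r (pk a).2 <= C * r (pk j).2 by rewrite ler_pM2l.
  have h1 := ler_distD (pk a).1 a (pk j).1; have h2 := ler_distD z (pk a).1 (pk j).1.
  rewrite (distrC a (pk a).1) in h1; rewrite (distrC z) in h2; lra.
apply: (@le_trans _ _ (\sum_(0 <= k <oo) hausdorff_gauge n (W k))%E).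
  apply: ereal_inf_lbound; exists W => //; split => // k.
  case kj : (sel k) => [a|]; last first.
    by rewrite /W kj; apply: ediam_le => x y [].
  apply: ediam_le => x y Wx Wy; apply: le_trans (Wdiam k a kj x y Wx Wy) _.
  by apply: le_trans sd; rewrite mulrC ler_pM2r.
apply: (@le_trans _ _ ((c2 ^+ n / al ^+ 2 * eta)%:E)); last first.
  rewrite lee_fin mulrC -ler_pdivlMr ?divr_gt0 ?exprn_gt0//.
  have -> : e / (c2 ^+ n / al ^+ 2) = e * al ^+ 2 / c2 ^+ n by rewrite invf_div mulrA.
  by rewrite /eta ge_min lexx orbT.
apply: lime_le.
  by apply: is_cvg_nneseries => k _ _; exact: hausdorff_gauge_ge0.
apply: nearW => N.
(* Each gauge is at most [(c2 * r) ^+ n], and [r ^+ n] is at most the energy of the selected ball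
   over [al ^+ 2]; these balls are disjoint, so their energies add up to at most [eta]. *)
apply: (@le_trans _ _ ((c2 ^+ n / al ^+ 2 * \sum_(k < N) energy D g (G k))%:E)).
  rewrite mulr_sumr -sumEFin big_mkord; apply: lee_sum => k _.
  case kj : (sel k) => [a|]; last first.
    rewrite /W kj hausdorff_gauge0 lee_fin mulr_ge0 ?divr_ge0 ?exprn_ge0 ?(ltW c20) ?(ltW al0)//.
    exact: energy_ge0.
  have cr : 0 <= c2 * r (pk a).2 by rewrite mulr_ge0 ?(ltW c20) ?(ltW (r0 _)).
  apply: le_trans (hausdorff_gauge_le _ cr (Wdiam k a kj)) _.
  rewrite lee_fin exprMn -mulrA ler_pM2l ?exprn_gt0// mulrC ler_pdivlMr ?exprn_gt0// mulrC.
  by rewrite /G kj; have [_ _] := pkP a (selV _ _ kj).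
rewrite lee_fin ler_pM2l ?divr_gt0 ?exprn_gt0// -lee_fin; apply: le_trans gfin.
have mGN : measurable (\big[setU/set0]_(k < N) G k) by exact: bigsetU_measurable.
apply: le_trans (energy_le mD fg.1 mGN).
by rewrite lee_fin; exact: (energy_trivIset mD fg.1 N mG tsel).
Qed.

(** Cubes cut the boundary into countably many compact pieces, each covered by finitely many of the
    local neighbourhoods. *)
Lemma Cap0_null (D A : set E) : open D -> bilipschitz_boundary D ->
  A `<=` bd D -> Cap D A = 0%E -> hausdorff n A = 0%E.
Proof.
move=> oD A1 AD capA; apply/eqP; rewrite eq_le outer_measure_ge0 andbT.
apply: (@le_trans _ _ (hausdorff n (\bigcup_k (A `&` cube k)))).
  apply: le_outer_measure => x Ax; have [k xk] := cube_cover x.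
  by exists k.
apply: le_trans (outer_measure_sigma_subadditive _ _) _.
rewrite eseries0// => k _ _.
have cK : compact (cube k `&` bd D).
  by apply: compact_closedI; [exact: cube_compact | exact: bd_closed].
suff K0 : hausdorff n (A `&` (cube k `&` bd D)) = 0%E.
  by rewrite -K0; congr hausdorff; apply/seteqP; split => x [Ax]; [split => //; split => //; exact: AD | case].
apply: (compact_local (P := fun X => hausdorff n (A `&` X) = 0%E)) cK _ _ _ _.
- by rewrite setI0 outer_measure0.
- move=> X Y XY Y0; apply/eqP; rewrite eq_le outer_measure_ge0 andbT -Y0.
  by apply: le_outer_measure; exact: setIS.
- move=> X Y X0 Y0; apply/eqP; rewrite eq_le outer_measure_ge0 andbT setIUr.
  by apply: le_trans (outer_measureU2 _ _ _) _; rewrite [X in (X + _ <= _)%E]X0 [X in (_ + X <= _)%E]Y0 adde0.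
move=> b [_ bb]; have [rho rho0 H0] := Cap0_locally_null oD A1 AD capA bb.
exists rho => //; apply/eqP; rewrite eq_le outer_measure_ge0 andbT -H0.
by apply: le_outer_measure => x [Ax [_ xb]].
Qed.

End capacity_null.

Unset Implicit Arguments.

Theorem proposition2p4 (R : realType) (d : nat) (d_ge2 : (2 <= d)%N)
    (D : set 'rV[R]_d) (D_open : open D) (D_connected : connected D)
    (A1 : bilipschitz_boundary D) (A3 : regular_form D) :
  radon_on (bd D) (surface D) /\
  forall A : set 'rV[R]_d, A `<=` bd D -> Cap D A = 0%E -> surface D A = 0%E.
Proof.
case: d d_ge2 D D_open D_connected A1 A3 => // n _ D D_open _ A1 _.
split; first exact: radon_surface.
by move=> A AD capA; rewrite /surface (setIidl AD); exact: Cap0_null capA.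
Qed.
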